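(* Let $X$ be an infinite dimensional real Banach space which admits an equivalent URED norm. Then there exists an equivalent norm on $X$ which is URED and not WUR, and the class of all equivalent norms on $X$ which are URED and not WUR is dense. If, in addition, $X$ admits an equivalent LUR norm, then there exists an equivalent norm on $X$ which is URED, LUR and not WUR, and the class of all equivalent norms on $X$ which are URED, LUR and not WUR is dense.
   Context: All Banach spaces are real. For a norm $\|\cdot\|$ on $X$, write $B_{\|\cdot\|}=\{x\in X:\|x\|\le 1\}$ and $S_{\|\cdot\|}=\{x\in X:\|x\|=1\}$. An equivalent norm $\|\cdot\|$ on $X$ is weakly uniformly rotund (WUR) if for every pair of sequences $(x_n)_{n\in\mathbb N}$, $(y_n)_{n\in\mathbb N}$ in $B_{\|\cdot\|}$ with $\left\|\frac{x_n+y_n}{2}\right\|\to 1$ one has $y_n-x_n\to 0$ in the weak topology of $X$. An equivalent norm $\|\cdot\|$ on $X$ is uniformly rotund in every direction (URED) if for every $v\in S_{\|\cdot\|}$ and every pair of sequences $(x_n)_{n\in\mathbb N}$, $(y_n)_{n\in\mathbb N}$ in $B_{\|\cdot\|}$ such that $y_n-x_n=\lambda_n v$ for some $\lambda_n\in\mathbb R$ (for every $n$) and $\left\|\frac{x_n+y_n}{2}\right\|\to 1$, one has $\lambda_n\to 0$. An equivalent norm $\|\cdot\|$ on $X$ is locally uniformly rotund (LUR) at $x\in S_{\|\cdot\|}$ if for every sequence $(y_n)_{n\in\mathbb N}$ in $B_{\|\cdot\|}$ with $\left\|\frac{x+y_n}{2}\right\|\to 1$ one has $\|x-y_n\|\to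 0$. The norm is LUR if it is LUR at every $x\in S_{\|\cdot\|}$. A class $\mathcal S$ of equivalent norms on $X$ is dense if for every equivalent norm $\|\cdot\|$ on $X$ and every $\varepsilon>0$ there exists a norm $N\in\mathcal S$ such that $N(x)\le\|x\|\le(1+\varepsilon)N(x)$ for all $x\in X$. *)

(* Defs.v *)
From mathcomp Require Import all_boot all_order all_algebra.
From mathcomp Require Import all_classical all_reals all_analysis.

Set Implicit Arguments.
Unset Strict Implicit.
Unset Printing Implicit Defensive.

Import Order.TTheory GRing.Theory Num.Theory.
Import numFieldNormedType.Exports.

Local Open Scope classical_set_scope.
Local Open Scope ring_scope.

Definition finite_dimensional (R : realType) (X : lmodType R) : Prop :=
  exists s : seq X, forall x : X,
    exists c : 'I_(size s) -> R, x = \sum_(i < size s) c i *: s`_i.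

Definition infinite_dimensional (R : realType) (X : lmodType R) : Prop :=
  ~ finite_dimensional X.

Definition dual (R : realType) (X : normedModType R) : Type :=
  {f : {linear X -> R^o} | continuous (f : X -> R^o)}.

Definition weak_topology (R : realType) (X : normedModType R) :
    topologicalType :=
  sup_topology (fun f : dual X =>
    Topological.class (initial_topology (sval f : X -> R^o))).

Section norms.
Context (R : realType) (X : normedModType R).
Implicit Types (N : X -> R) (S : set (X -> R)).

Record is_norm N : Prop := IsNorm {
  is_norm_triangle : forall x y, N (x + y) <= N x + N y ;
  is_norm_homog : forall (a : R) x, N (a *: x) = `|a| * N x ;
  is_norm_eq0 : forall x, N x = 0 -> x = 0 }.

(* The ambient norm `|_| only fixes the class of equivalent norms; all the
   rotundity notions below refer to [N]. *)
Definition equivalent_norm N : Prop :=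
  is_norm N /\
  exists c C : R, [/\ 0 < c, 0 < C &
    forall x, c * `|x| <= N x /\ N x <= C * `|x|].

Definition unit_ball N : set X := [set x | N x <= 1].
Definition unit_sphere N : set X := [set x | N x = 1].

Definition WUR N : Prop :=
  forall x y : nat -> X,
    (forall n, unit_ball N (x n)) -> (forall n, unit_ball N (y n)) ->
    N (2^-1 *: (x n + y n)) @[n --> \oo] --> (1 : R) ->
    (y n - x n) @[n --> \oo] --> (0 : weak_topology X).

Definition URED N : Prop :=
  forall v, unit_sphere N v ->
  forall (x y : nat -> X) (lambda : nat -> R),
    (forall n, unit_ball N (x n)) -> (forall n, unit_ball N (y n)) ->
    (forall n, y n - x n = lambda n *: v) ->
    N (2^-1 *: (x n + y n)) @[n --> \oo] --> (1 : R) ->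
    lambda n @[n --> \oo] --> (0 : R).

Definition LUR_at N (x : X) : Prop :=
  forall y : nat -> X,
    (forall n, unit_ball N (y n)) ->
    N (2^-1 *: (x + y n)) @[n --> \oo] --> (1 : R) ->
    N (x - y n) @[n --> \oo] --> (0 : R).

Definition LUR N : Prop := forall x, unit_sphere N x -> LUR_at N x.

(* Density of a class of equivalent norms, i.e. meant for
   [S `<=` equivalent_norm]. *)
Definition dense_norms S : Prop :=
  forall M, equivalent_norm M -> forall eps : R, 0 < eps ->
    exists N, S N /\ forall x, N x <= M x /\ M x <= (1 + eps) * N x.

End norms.

Lemma weak_cvgP (R : realType) (X : normedModType R) (u : nat -> X) (l : X) :
  (u n @[n --> \oo] --> (l : weak_topology X)) <->
  (forall f : {linear X -> R^o}, continuous (f : X -> R^o) ->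
     f (u n) @[n --> \oo] --> (f l : R)).
Proof.
split=> [ul f cf|ul].
- move/cvg_sup: ul => /(_ (exist _ f cf)) ul.
  exact: (cvg_comp _ _ ul (@initial_continuous _ _ (f : X -> R^o) l)).
- apply/cvg_sup => -[f cf] A /= [B [[C oC <-] Cl] BA].
  apply: filterS BA _; apply: (ul f cf).
  exact: open_nbhs_nbhs.
Qed.

(* Main.v *)
From HB Require Import structures.
Require Import Defs.
From mathcomp Require Import all_boot all_order all_algebra.
From mathcomp Require Import all_classical all_reals all_analysis.
From mathcomp Require Import ring lra zify.

Set Implicit Arguments.
Unset Strict Implicit.
Unset Printing Implicit Defensive.

Import Order.TTheory GRing.Theory Num.Theory.
Import numFieldNormedType.Exports.

Local Open Scope classical_set_scope.
Local Open Scope ring_scope.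

(** The defect of a seminorm [p] on a pair is
    [p x ^+ 2 / 2 + p y ^+ 2 / 2 - p ((x + y) / 2) ^+ 2]; it is nonnegative, and
    it is additive when seminorms are added in the l2 sense.  URED and LUR say
    that a small defect forces [x] and [y] to be close (along a fixed direction,
    resp. at a fixed point), so both properties pass from [V] to any l2-sum
    containing [V].  A summand that is uniformly rotund in the weak sense would
    however force WUR, so a norm that is not WUR has to be built as a supremum,
    of pieces each of which is flat in a direction of its own, while every fixed
    direction meets a rotundity that does not degrade along the pieces.

    Fix a norm [M] to approximate and a seminorm [V] with the rotundity wanted.
    Infinite dimension yields a point [u] and functionals [g], [f], a vector [e]
    with [f e = 1], and bounded sequences [w n], [h n] that are triangular
    ([h m (w n) = 0] for [m < n]), with [h n (w n) = 1] and [h m (w n)] small for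
    [m > n] ([exists_frame]; this rests on the Hahn-Banach theorem and a
    pigeonhole argument).  The ball of [M] is truncated near [u]: first by a slab
    bounding [`|g|] slightly below 1, whose face is then covered by many shallow
    roofs, the level sets of [`|g x| + s * `|h n x|]; the roof of index [n]
    dominates near [u + 4 * s *: w n].  It is constant along
    [flat_dir n = e + w n.+1], a direction on which [f] is 1.  The l2-corrections
    added to the roof of index [n] are [V] composed with the projection
    [collapse n] killing [flat_dir n], the functionals [h j], [j <= n], which
    vanish on [flat_dir n] too, and the multiple [rate n] of [V], where [rate n]
    tends to [0].  Hence near the unit sphere there are segments, flat up to an
    error that tends to [0], along which [f] varies by an amount bounded below:
    the new norm is not WUR ([new_norm_not_WUR]).

    It is URED ([new_norm_URED]): given [v], if [h j v != 0] for some [j] then all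
    roofs of index [n >= j] see [v] through [h j], and the finitely many other
    pieces through a multiple of [V]; if [h j v = 0] for all [j] then [collapse n]
    fixes [v], and [V] itself controls [v] uniformly in [n].

    For LUR ([new_norm_LUR]) one needs that at a given point only finitely many
    pieces compete.  The base piece of index [0] therefore contains
    [3 / 4 * s * sup (`|h i| + `|h j|)], the supremum over [i != j]: at a given
    point all [`|h n x|] but one are at most half of it, so all roofs but one
    stay strictly below the base piece ([piece_gap]), and for the two pieces left
    the multiple of [V] is enough. *)

(** * Functionals and the Hahn-Banach theorem *)

Section HahnBanach.
Context (R : realType) (X : lmodType R).
Implicit Types (p N g : X -> R) (x y : X).

Definition seminorm N : Prop :=
  (forall x y, N (x + y) <= N x + N y) /\
  (forall (a : R) x, N (a *: x) = `|a| * N x).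

(** A bare predicate rather than a bundled linear map, so that functionals can
    be freely corrected by multiples of one another. *)
Definition functional g : Prop :=
  forall (a : R) x y, g (a *: x + y) = a * g x + g y.

Definition sublinear p : Prop :=
  (forall x y, p (x + y) <= p x + p y) /\
  (forall (t : R) x, 0 < t -> p (t *: x) <= t * p x).

Lemma sublinear_seminorm N : seminorm N -> sublinear N.
Proof. by move=> [ND NZ]; split=> // t x t0; rewrite NZ gtr0_norm. Qed.

Lemma sublinear_ge p x : sublinear p -> - p (- x) <= p x.
Proof.
move=> [pD _]; have := pD 0 0; have := pD x (- x).
by rewrite subrr addr0; lra.
Qed.

Lemma sublinear_scale p (t : R) x : sublinear p -> 0 <= t -> t * p x <= p (t *: x).
Proof.
move=> [pD pZ]; rewrite le_eqVlt => /predU1P[<-|t0].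
  by have := pD 0 0; rewrite scale0r addr0 mul0r; lra.
have := pZ t^-1 (t *: x); rewrite invr_gt0 => /(_ t0).
by rewrite scalerA mulVf ?gt_eqF// scale1r mulrC ler_pdivlMr// mulrC.
Qed.

Let dir_set p y x : set R :=
  [set r | exists2 t : R, 0 <= t & r = p (x + t *: y) - t * p y].

(** The largest sublinear functional below [p] whose value at [- y] is at most
    [- p y]. *)
Definition dir_min p y x : R := inf (dir_set p y x).

Let dir_set_neq0 p y x : dir_set p y x !=set0.
Proof. by exists (p x), 0; rewrite // scale0r addr0 mul0r subr0. Qed.

Let dir_min_lb p y x (t : R) : sublinear p -> 0 <= t ->
  dir_min p y x <= p (x + t *: y) - t * p y.
Proof.
move=> sp t0; apply: ge_inf; last by exists t.
exists (- p (- x)) => _ [u u0 ->]; have := sublinear_scale y sp u0.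
have [pD _] := sp; have := pD (x + u *: y) (- x).
by rewrite addrAC subrr add0r; lra.
Qed.

Lemma dir_min_le p y x : sublinear p -> dir_min p y x <= p x.
Proof.
move=> sp; have := dir_min_lb y x sp (lexx 0).
by rewrite scale0r addr0 mul0r subr0.
Qed.

Lemma dir_min_sublinear p y : sublinear p -> sublinear (dir_min p y).
Proof.
move=> sp; have [pD pZ] := sp; split=> [x x'|t x t0].
  rewrite -lerBlDr; apply: lb_le_inf => // _ [u u0 ->].
  rewrite lerBlDr [leRHS]addrC -lerBlDr; apply: lb_le_inf => // _ [v v0 ->].
  rewrite lerBlDr; apply: (le_trans (dir_min_lb _ _ sp (addr_ge0 u0 v0))).
  have := pD (x + u *: y) (x' + v *: y).
  by rewrite scalerDl addrACA mulrDl; lra.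
rewrite mulrC -ler_pdivrMr//; apply: lb_le_inf => // _ [u u0 ->].
rewrite ler_pdivrMr//.
apply: (le_trans (dir_min_lb _ _ sp (mulr_ge0 u0 (ltW t0)))).
rewrite (mulrC u t) -scalerA -scalerDr.
by have := pZ t (x + u *: y) t0; lra.
Qed.

(** Minimality makes [p] equal to each [dir_min p y], whose definition (at
    [t = 1]) gives [p x <= p (x + y) - p y], the missing half of additivity. *)
Lemma minimal_sublinear_functional p : sublinear p ->
  (forall p', sublinear p' -> (forall x, p' x <= p x) ->
     forall x, p x <= p' x) ->
  functional p.
Proof.
move=> sp minp.
have pD x y : p (x + y) = p x + p y.
  apply/eqP; rewrite eq_le sp.1 /=.
  have /(_ x) := minp _ (dir_min_sublinear y sp) (fun z => dir_min_le y z sp).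
  have := dir_min_lb y x sp ler01.
  by rewrite scale1r mul1r; lra.
have p0 : p 0 = 0 by have := pD 0 0; rewrite addr0; lra.
have pN x : p (- x) = - p x by have := pD x (- x); rewrite subrr p0; lra.
have pZ0 (t : R) x : 0 < t -> p (t *: x) = t * p x.
  by move=> t0; apply/eqP; rewrite eq_le sp.2//= sublinear_scale// ltW.
move=> a x y; rewrite pD; congr (_ + _).
have [a0|a0|->] := ltgtP a 0; last by rewrite scale0r mul0r.
  by rewrite -[a in LHS]opprK scaleNr pN pZ0 ?oppr_gt0// mulNr opprK.
exact: pZ0.
Qed.

(** Zorn's lemma: the infimum of a chain of sublinear functionals is
    sublinear, and it is finite because [- p (- x)] bounds the chain below. *)
Lemma sublinear_dominates_functional p : sublinear p ->
  exists2 g, functional g & forall x, g x <= p x.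
Proof.
move=> sp.
pose T := {p' : X -> R | sublinear p' /\ forall x, p' x <= p x}.
pose le (s t : T) := `[< forall x, sval t x <= sval s x >].
pose p0 : T := exist _ p (conj sp (fun x => lexx (p x))).
have [||A totA|[g [sg gp]] ming] := ZL_preorder p0 (R := le).
- by move=> t; apply/asboolP.
- move=> r s t /asboolP rs /asboolP st; apply/asboolP => x.
  exact: le_trans (rs x).
- have [[s0 As0]|A0] := pselect (A !=set0); last first.
    by exists p0 => s As; exfalso; apply: A0; exists s.
  pose E x := [set sval s x | s in A].
  have E0 x : E x !=set0 by exists (sval s0 x), s0.
  have lbE x : lbound (E x) (- p (- x)).
    move=> _ [[s [ss sp']] As <-] /=; have := sublinear_ge x ss.
    by apply: le_trans; rewrite lerN2.
  have infE x s : A s -> inf (E x) <= sval s x.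
    by move=> As; apply: ge_inf; [exists (- p (- x)); exact: lbE|exists s].
  have sinf : sublinear (fun x => inf (E x)).
    split=> [x y|t x t0].
      rewrite -lerBlDr; apply: lb_le_inf => // _ [s As <-].
      rewrite lerBlDr [leRHS]addrC -lerBlDr; apply: lb_le_inf => // _ [r Ar <-].
      rewrite lerBlDr; have [/asboolP sr|/asboolP rs] := totA _ _ As Ar.
        apply: (le_trans (infE _ _ Ar)).
        by apply: le_trans ((svalP r).1.1 x y) _; rewrite addrC lerD2l.
      apply: (le_trans (infE _ _ As)).
      by apply: le_trans ((svalP s).1.1 x y) _; rewrite addrC lerD2r.
    rewrite mulrC -ler_pdivrMr//; apply: lb_le_inf => // _ [s As <-].
    rewrite ler_pdivrMr// mulrC; apply: (le_trans (infE _ _ As)).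
    exact: (svalP s).1.2.
  have infp x : inf (E x) <= p x.
    by apply: le_trans (infE x _ As0) _; exact: (svalP s0).2.
  pose pinf : T := exist _ (fun x => inf (E x)) (conj sinf infp).
  by exists pinf => s As; apply/asboolP => x; exact: infE.
exists g => //; apply: minimal_sublinear_functional => // p' sp' p'g.
have p'p x : p' x <= p x by apply: le_trans (gp x).
pose t' : T := exist _ p' (conj sp' p'p).
exact: asboolW (ming t' (asboolT p'g)).
Qed.

Lemma functional0 g : functional g -> g 0 = 0.
Proof. by move=> gl; have := gl 1 0 0; rewrite scaler0 addr0; lra. Qed.

Lemma functionalZ g a x : functional g -> g (a *: x) = a * g x.
Proof. by move=> gl; have := gl a x 0; rewrite !addr0 functional0// addr0. Qed.

Lemma functionalD g x y : functional g -> g (x + y) = g x + g y.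
Proof. by move=> gl; have := gl 1 x y; rewrite scale1r mul1r. Qed.

Lemma functionalN g x : functional g -> g (- x) = - g x.
Proof. by move=> gl; rewrite -scaleN1r functionalZ// mulN1r. Qed.

Lemma functionalB g x y : functional g -> g (x - y) = g x - g y.
Proof. by move=> gl; rewrite functionalD// functionalN. Qed.

Lemma functional_comb g h (a : R) : functional g -> functional h ->
  functional (fun x => h x - a * g x).
Proof. by move=> gl hl b x y; rewrite gl hl; ring. Qed.

Lemma functional_bound g N : functional g -> seminorm N ->
  (forall x, g x <= N x) -> forall x, `|g x| <= N x.
Proof.
move=> gl [_ NZ] gN x; rewrite ler_norml gN andbT lerNl.
by have := gN (- x); rewrite functionalN// -scaleN1r NZ normrN1 mul1r.
Qed.

(** A functional below [dir_min N v] takes a value at most [- N v] at [- v]. *)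
Lemma norming_functional N v : seminorm N ->
  exists g, [/\ functional g, forall x, `|g x| <= N x & g v = N v].
Proof.
move=> sN; have sl := sublinear_seminorm sN.
have [g gl gp] := sublinear_dominates_functional (dir_min_sublinear v sl).
have gN := functional_bound gl sN (fun x => le_trans (gp x) (dir_min_le v x sl)).
exists g; split => //; apply/eqP; rewrite eq_le; apply/andP; split.
  exact: le_trans (ler_norm _) (gN _).
have := le_trans (gp (- v)) (dir_min_lb v (- v) sl ler01).
rewrite scale1r addNr mul1r functionalN//.
by have := sN.2 0 0; rewrite scaler0 normr0 mul0r => ->; lra.
Qed.

End HahnBanach.

(** * Triangular systems of vectors and functionals *)

(** Dependent choice in which each term is constrained by all previous ones;
    the prefix is stored as a list to make the recursion structural. *)
Lemma sequential_choice (T : Type) (t0 : T) (Q : T -> Prop) (S : T -> T -> Prop) :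
  (forall n (u : nat -> T), (forall k, (k < n)%N -> Q (u k)) ->
     exists t, Q t /\ forall k, (k < n)%N -> S (u k) t) ->
  exists u : nat -> T, (forall n, Q (u n)) /\
    forall k n, (k < n)%N -> S (u k) (u n).
Proof.
move=> step.
have /choice[F HF] : forall l : seq T, exists t,
    (forall k, (k < size l)%N -> Q (nth t0 l k)) ->
    Q t /\ forall k, (k < size l)%N -> S (nth t0 l k) t.
  move=> l; have [Ql|nQl] := pselect (forall k, (k < size l)%N -> Q (nth t0 l k)).
    by have [t Ht] := step _ _ Ql; exists t.
  by exists t0.
pose L := fix L n := if n is m.+1 then rcons (L m) (F (L m)) else [::].
have sL n : size (L n) = n by elim: n => //= n IH; rewrite size_rcons IH.
pose u n := F (L n).
have nthL n k : (k < n)%N -> nth t0 (L n) k = u k.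
  elim: n => // n IH; rewrite ltnS leq_eqVlt /= nth_rcons sL => /predU1P[->|kn].
    by rewrite ltnn eqxx.
  by rewrite kn IH.
have uQ n : Q (u n) /\ forall k, (k < n)%N -> S (u k) (u n).
  elim/ltn_ind: n => n IH; have [] := HF (L n).
    by move=> k; rewrite sL => kn; rewrite nthL//; exact: (IH _ kn).1.
  move=> Qn Sn; split=> // k kn; have := Sn k.
  by rewrite sL nthL// => /(_ kn).
by exists u; split=> [n|k n kn]; [exact: (uQ n).1|exact: (uQ n).2].
Qed.

Section TriangularSystems.
Context (R : realType) (X : lmodType R).
Implicit Types (N g h : X -> R) (x y w : X).

(** Induction on [n]: a functional that is not zero on the common kernel of
    the previous ones costs exactly one more vector [z]. *)
Lemma common_kernel_finite_codim (g : nat -> X -> R) n :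
  (forall k, (k < n)%N -> functional (g k)) ->
  exists s : seq X, forall x, exists c : 'I_(size s) -> R,
    forall k, (k < n)%N -> g k (x - \sum_(i < size s) c i *: s`_i) = 0.
Proof.
elim: n => [|n IH] gl; first by exists [::] => x; exists (fun=> 0).
have [k kn|s Hs] := IH; first exact/gl/ltnW.
have [[z [gz0 gnz]]|H] :=
  pselect (exists z, (forall k, (k < n)%N -> g k z = 0) /\ g n z != 0).
- exists (z :: s) => x; have [c Hc] := Hs x.
  set r := x - _ in Hc.
  exists (fun i => if unlift ord0 i is Some j then c j else g n r / g n z).
  move=> k; rewrite big_ord_recl /= unlift_none.
  under eq_bigr do rewrite liftK.
  rewrite addrC opprD -addrA [- _ + x]addrC -/r addrC ltnS leq_eqVlt.
  move=> kn; have gk : functional (g k) by apply: gl; rewrite ltnS leq_eqVlt.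
  rewrite (functionalB _ _ gk) (functionalZ _ _ gk).
  case/predU1P: kn => [->|kn]; first by rewrite divfK// subrr.
  by rewrite (Hc _ kn) (gz0 _ kn) mulr0 subr0.
- exists s => x; have [c Hc] := Hs x; exists c => k.
  rewrite ltnS leq_eqVlt => /predU1P[->|]; last exact: Hc.
  by apply/eqP; apply: contra_notT H => H; eexists; split; first exact: Hc.
Qed.

Lemma common_kernel_neq0 (g : nat -> X -> R) n :
  infinite_dimensional X -> (forall k, (k < n)%N -> functional (g k)) ->
  exists x, x <> 0 /\ forall k, (k < n)%N -> g k x = 0.
Proof.
move=> infX gl; apply: contrapT => H; apply: infX.
have [s Hs] := common_kernel_finite_codim gl.
exists s => x; have [c Hc] := Hs x; exists c.
apply/eqP; rewrite -subr_eq0; apply/eqP; apply: contrapT => r0.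
by apply: H; eexists; split; first exact: r0.
Qed.

(** The interval [-1, 1] is cut into 17 cells of width 1/8 (the last one only
    contains the end point), and there are finitely many functions from
    ['I_n] to the cells. *)
Lemma pigeonhole_close (f : nat -> nat -> R) n :
  (forall i k, (k < n)%N -> `|f i k| <= 1) ->
  exists i j, (i < j)%N /\ forall k, (k < n)%N -> `|f j k - f i k| <= 8^-1.
Proof.
move=> f1; pose m := #|{ffun 'I_n -> 'I_17}|.
pose cell (i : 'I_m.+1) : {ffun 'I_n -> 'I_17} :=
  [ffun k : 'I_n => inord (Num.truncn (8 * (f i k + 1)))].
have : ~~ injectiveb cell.
  by apply/injectiveP => /leq_card; rewrite card_ord ltnn.
move=> /injectivePn[i [j ij cij]].
have close k : (k < n)%N -> `|f j k - f i k| <= 8^-1.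
  move=> kn; pose k' := Ordinal kn.
  have := congr1 (fun c : {ffun 'I_n -> 'I_17} => val (c k')) cij.
  have pos a : `|f a k| <= 1 -> 0 <= 8 * (f a k + 1) <= 16.
    by rewrite ler_norml; lra.
  have /andP[fi0 fi1] := pos _ (f1 i k kn); have /andP[fj0 fj1] := pos _ (f1 j k kn).
  have lt17 (a : R) : 0 <= a -> a <= 16 -> (Num.truncn a < 17)%N.
    by move=> a0 a16; rewrite ltnS -(ler_nat R) (le_trans _ a16)// truncn_le.
  rewrite !ffunE/= !inordK; try exact: lt17.
  move=> eqt; have := truncn_itv fi0; have := truncn_itv fj0.
  rewrite eqt; move: (Num.truncn _) => m' /andP[+ +] /andP[+ +].
  rewrite -[m'.+1%:R]natr1 ler_norml; move: (m'%:R) => t ? ? ? ?.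
  by apply/andP; split; lra.
have [ltij|ltji|eqij] := ltngtP i j.
- by exists i, j.
- by exists j, i; split=> // k kn; rewrite distrC; exact: close.
- by move: ij; rewrite (val_inj eqij) eqxx.
Qed.

(** Choose norming functionals [p i] of unit vectors [v i] lying in the kernels of
    the [h k] and of the previous [p i].  By pigeonhole two of the [p i], say
    [i < j], are close on all the [w k]; as [p i (v j) = 0], the difference
    [p j - p i] still takes the value 1 at [v j].  This replaces the choice of a
    basic sequence. *)
Lemma triangular_step N (h : nat -> X -> R) (w : nat -> X) n :
  infinite_dimensional X -> seminorm N -> (forall x, N x = 0 -> x = 0) ->
  (forall k, (k < n)%N -> functional (h k)) ->
  (forall k, (k < n)%N -> N (w k) <= 1) ->
  exists g v, [/\ functional g, forall x, `|g x| <= 2 * N x, N v = 1, g v = 1 &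
    forall k, (k < n)%N -> h k v = 0 /\ `|g (w k)| <= 8^-1].
Proof.
move=> infX sN N0 hl wN.
pose Q (t : (X -> R) * X) := [/\ functional t.1, forall x, `|t.1 x| <= N x,
  N t.2 = 1, t.1 t.2 = 1 & forall k, (k < n)%N -> h k t.2 = 0].
have [|u [uQ uS]] :=
    @sequential_choice _ (h 0%N, 0) Q (fun s t => s.1 t.2 = 0).
  move=> m u uQ; pose g k := if (k < n)%N then h k else (u (k - n)%N).1.
  have gl k : (k < n + m)%N -> functional (g k).
    rewrite /g; case: (ltnP k n) => [kn _|nk kmn]; first exact: hl.
    have kn : (k - n < m)%N by lia.
    by have [] := uQ _ kn.
  have [x [x0 gx]] := common_kernel_neq0 infX gl.
  have Nx0 : 0 < N x.
    rewrite lt_neqAle; apply/andP; split.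
      by apply/eqP => /esym/N0.
    have := sN.1 x (- x); rewrite -scaleN1r sN.2 normrN1 mul1r scaleN1r subrr.
    by have := sN.2 0 0; rewrite scaler0 normr0 mul0r => ->; lra.
  pose v := (N x)^-1 *: x.
  have gv k : (k < n + m)%N -> g k v = 0.
    by move=> kn; rewrite (functionalZ _ _ (gl _ kn)) gx// mulr0.
  have Nv : N v = 1 by rewrite sN.2 gtr0_norm ?invr_gt0// mulVf ?gt_eqF.
  have [p [pl pN pv]] := norming_functional v sN.
  exists (p, v); split; first split => //=; first by rewrite pv.
    by move=> k kn; have := gv k; rewrite /g kn; apply; lia.
  move=> k km /=; have := gv (n + k)%N.
  by rewrite /g (ltnNge _ n) leq_addr /= addKn ltn_add2l; apply.
have [|i [j [ij close]]] := @pigeonhole_close (fun i k => (u i).1 (w k)) n.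
  by move=> i k kn; have [_ uN _ _ _] := uQ i; apply: le_trans (uN _) (wN _ kn).
have [il iN _ _ _] := uQ i; have [jl jN j1 jj jh] := uQ j.
exists (fun x => (u j).1 x - 1 * (u i).1 x), (u j).2; split.
- exact: functional_comb.
- move=> x; apply: (le_trans (ler_normB _ _)); rewrite mul1r.
  by have := iN x; have := jN x; lra.
- by [].
- by rewrite jj uS// mulr0 subr0.
- by move=> k kn; split; [exact: jh|rewrite mul1r; exact: close].
Qed.

End TriangularSystems.

(** * The frame supporting the construction *)

Section Frames.
Context (R : realType) (X : lmodType R).

(** The slab is cut by [g] at [u]; [e] and [f] witness that the flat directions
    are not weakly null; [w] and [h] index the roofs. *)
Record frame (N : X -> R) (u e : X) (g f : X -> R)
    (w : nat -> X) (h : nat -> X -> R) : Prop := Frame {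
  frame_g : functional g ;
  frame_f : functional f ;
  frame_h : forall n, functional (h n) ;
  frame_gN : forall x, `|g x| <= N x ;
  frame_fN : forall x, `|f x| <= 3 * N x ;
  frame_hN : forall n x, `|h n x| <= 3 * N x ;
  frame_Nu : N u = 1 ;
  frame_Ne : N e = 1 ;
  frame_Nw : forall n, N (w n) = 1 ;
  frame_gu : g u = 1 ;
  frame_ge : g e = 0 ;
  frame_gw : forall n, g (w n) = 0 ;
  frame_fe : f e = 1 ;
  frame_fw : forall n, f (w n) = 0 ;
  frame_hu : forall n, h n u = 0 ;
  frame_he : forall n, h n e = 0 ;
  frame_hw_diag : forall n, h n (w n) = 1 ;
  frame_hw_lt : forall m n, (m < n)%N -> h m (w n) = 0 ;
  frame_hw_gt : forall m n, (n < m)%N -> `|h m (w n)| <= 8^-1 }.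

Lemma exists_frame (N : X -> R) : infinite_dimensional X -> seminorm N ->
  (forall x, N x = 0 -> x = 0) ->
  exists u e g f w h, frame N u e g f w h.
Proof.
move=> infX sN N0; have step := triangular_step infX sN N0.
have [//|//|_ [u [_ _ Nu _ _]]] := step (fun=> N) (fun=> 0) 0%N.
have [g [gl gN gu]] := norming_functional u sN; rewrite Nu in gu.
have [||f [e [fl fN Ne fe /(_ 0%N isT)[ge fu]]]] :=
    step (fun=> g) (fun=> u) 1%N.
- by move=> k _; exact: gl.
- by move=> k _; rewrite Nu.
pose Q (t : (X -> R) * X) := [/\ functional t.1, forall x, `|t.1 x| <= 2 * N x,
  N t.2 = 1, t.1 t.2 = 1 &
  [/\ g t.2 = 0, f t.2 = 0, `|t.1 u| <= 8^-1 & `|t.1 e| <= 8^-1]].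
have [|s [sQ sS]] := @sequential_choice _ (g, u) Q
    (fun s t => s.1 t.2 = 0 /\ `|t.1 s.2| <= 8^-1).
  move=> n s sQ.
  (* The two pairs already chosen are put in front of the sequence under
     construction. *)
  pose h k := if k is k'.+1 then (if k' is j.+1 then (s j).1 else f) else g.
  pose w k := if k is k'.+1 then (if k' is j.+1 then (s j).2 else e) else u.
  have [|| k [v [kl kN Nv kv hw]]] := step h w n.+2.
  - by move=> [|[|k]]//=; rewrite !ltnS => /sQ[].
  - move=> [|[|k]]//=; rewrite ?Nu ?Ne ?lexx// !ltnS.
    by move=> /sQ[_ _ -> _ _].
  exists (k, v); split=> [|j jn]; last exact: (hw j.+2).
  have [gv ku] := hw 0%N isT; have [fv ke] := hw 1%N isT.
  by split.
(* The triangular step only makes [f] and the [h n] small at [u] and [e];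
   subtracting multiples of [g] and [f'] makes these values exactly 0, and the
   values at the [w n] do not change since [g] and [f] vanish there. *)
pose f' x := f x - f u * g x.
have f'l : functional f' by exact: functional_comb.
pose h n x := ((s n).1 x - (s n).1 u * g x) - (s n).1 e * f' x.
have f'N x : `|f' x| <= 3 * N x.
  apply: (le_trans (ler_normB _ _)); rewrite normrM.
  have := fN x; have := gN x; have := ler_pM (normr_ge0 _) (normr_ge0 _) fu (gN x).
  by move: (normr_ge0 (g x)); lra.
exists u, e, g, f', (fun n => (s n).2), h; split=> //.
- by move=> n; have [sl _ _ _ _] := sQ n; do 2?apply: functional_comb.
- move=> n x; have [_ sN2 _ _ [_ _ su se]] := sQ n.
  apply: (le_trans (ler_normB _ _)); rewrite normrM.
  have := ler_pM (normr_ge0 _) (normr_ge0 _) se (f'N x).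
  have := ler_normB ((s n).1 x) ((s n).1 u * g x); rewrite normrM.
  have := ler_pM (normr_ge0 _) (normr_ge0 _) su (gN x).
  have := sN2 x; have := normr_ge0 (g x); have := gN x; lra.
- by move=> n; have [] := sQ n.
- by move=> n; have [_ _ _ _ []] := sQ n.
- by rewrite /f' fe ge; ring.
- by move=> n; have [_ _ _ _ [gs fs _ _]] := sQ n; rewrite /f' gs fs; ring.
- by move=> n; rewrite /h /f' gu; ring.
- by move=> n; rewrite /h /f' ge fe; ring.
- by move=> n; have [_ _ _ ss [gs fs _ _]] := sQ n; rewrite /h /f' gs fs ss; ring.
- move=> m n mn; have [_ _ _ _ [gs fs _ _]] := sQ n.
  by rewrite /h /f' gs fs (sS _ _ mn).1; ring.
- move=> m n mn; have [_ _ _ _ [gs fs _ _]] := sQ n.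
  by rewrite /h /f' gs fs !mulr0 !subr0 mulr0 subr0; exact: (sS _ _ mn).2.
Qed.

End Frames.

(** * Seminorms and their convexity defect *)

Section Seminorms.
Context (R : realType) (X : lmodType R).
Implicit Types (p q N : X -> R) (x y : X).

Lemma seminorm0 p : seminorm p -> p 0 = 0.
Proof. by move=> [_ pZ]; have := pZ 0 0; rewrite scaler0 normr0 mul0r. Qed.

Lemma seminormN p x : seminorm p -> p (- x) = p x.
Proof. by move=> [_ pZ]; rewrite -scaleN1r pZ normrN1 mul1r. Qed.

Lemma seminorm_ge0 p x : seminorm p -> 0 <= p x.
Proof.
move=> sp; have := sp.1 x (- x).
by rewrite subrr seminorm0// seminormN//; lra.
Qed.

Lemma seminormB p x y : seminorm p -> p (x - y) <= p x + p y.
Proof. by move=> sp; rewrite -(seminormN y sp); exact: sp.1. Qed.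

Lemma seminormZ p (a : R) x : seminorm p -> 0 <= a -> p (a *: x) = a * p x.
Proof. by move=> [_ pZ] a0; rewrite pZ ger0_norm. Qed.

Lemma seminorm_zero : seminorm (fun _ : X => 0 : R).
Proof. by split=> [x y|a x]; rewrite ?addr0 ?mulr0. Qed.

Lemma seminorm_add p q : seminorm p -> seminorm q -> seminorm (fun x => p x + q x).
Proof.
move=> [pD pZ] [qD qZ]; split=> [x y|a x]; last by rewrite pZ qZ mulrDr.
by have := pD x y; have := qD x y; lra.
Qed.

Lemma seminorm_scale p (c : R) : 0 <= c -> seminorm p -> seminorm (fun x => c * p x).
Proof.
move=> c0 [pD pZ]; split=> [x y|a x]; last by rewrite pZ mulrCA.
by rewrite -mulrDr ler_wpM2l.
Qed.

Lemma seminorm_max p q : seminorm p -> seminorm q ->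
  seminorm (fun x => Num.max (p x) (q x)).
Proof.
move=> [pD pZ] [qD qZ]; split=> [x y|a x]; last by rewrite pZ qZ maxr_pMr.
rewrite ge_max; apply/andP; split.
  by apply: (le_trans (pD _ _)); rewrite lerD// le_max lexx.
by apply: (le_trans (qD _ _)); rewrite lerD// le_max lexx orbT.
Qed.

Lemma seminorm_functional (g : X -> R) : functional g -> seminorm (fun x => `|g x|).
Proof.
move=> gl; split=> [x y|a x]; first by rewrite functionalD// ler_normD.
by rewrite (functionalZ _ _ gl) normrM.
Qed.

Lemma seminorm_comp p (T : X -> X) :
  (forall (a : R) x y, T (a *: x + y) = a *: T x + T y) ->
  seminorm p -> seminorm (fun x => p (T x)).
Proof.
move=> Tl sp.
have T0 : T 0 = 0 by have := Tl (-1) 0 0; rewrite scaler0 addr0 scaleN1r addNr.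
split=> [x y|a x].
  by have := Tl 1 x y; rewrite !scale1r => ->; exact: sp.1.
by have := Tl a x 0; rewrite T0 !addr0 => ->; exact: sp.2.
Qed.

Definition l2sum p q x : R := Num.sqrt (p x ^+ 2 + q x ^+ 2).

Lemma l2sum_sqr p q x : l2sum p q x ^+ 2 = p x ^+ 2 + q x ^+ 2.
Proof. by rewrite sqr_sqrtr// addr_ge0 ?sqr_ge0. Qed.

Lemma l2sum_ge0 p q x : 0 <= l2sum p q x.
Proof. exact: sqrtr_ge0. Qed.

Lemma l2sum_le p q x : seminorm p -> seminorm q -> l2sum p q x <= p x + q x.
Proof.
move=> sp sq; have p0 := seminorm_ge0 x sp; have q0 := seminorm_ge0 x sq.
rewrite -(ler_pXn2r (n := 2)) ?nnegrE ?l2sum_ge0 ?addr_ge0//.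
by rewrite l2sum_sqr sqrrD addrAC lerDl mulrn_wge0// mulr_ge0.
Qed.

(** Minkowski's inequality in the plane, deduced from Cauchy-Schwarz. *)
Lemma seminorm_l2sum p q : seminorm p -> seminorm q -> seminorm (l2sum p q).
Proof.
move=> sp sq; split=> [x y|a x]; last first.
  rewrite /l2sum sp.2 sq.2 !exprMn -mulrDr sqrtrM ?sqr_ge0//.
  by rewrite sqrtr_sqr normr_id.
have xy0 : 0 <= l2sum p q x + l2sum p q y by rewrite addr_ge0 ?l2sum_ge0.
rewrite -(ler_pXn2r (n := 2)) ?nnegrE ?l2sum_ge0// sqrrD !l2sum_sqr.
have := sp.1 x y; have := sq.1 x y.
have := seminorm_ge0 (x + y) sp; have := seminorm_ge0 (x + y) sq.
move: (seminorm_ge0 x sp) (seminorm_ge0 y sp) (seminorm_ge0 x sq) (seminorm_ge0 y sq).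
have : p x * p y + q x * q y <= l2sum p q x * l2sum p q y.
  rewrite -[l2sum p q x * _]ger0_norm ?mulr_ge0 ?l2sum_ge0//.
  rewrite -sqrtr_sqr exprMn !l2sum_sqr (le_trans (ler_norm _))// -sqrtr_sqr.
  apply: ler_wsqrtr; rewrite -subr_ge0.
  have := sqr_ge0 (p x * q y - p y * q x); congr (0 <= _); ring.
move: (p (x + y)) (q (x + y)) => P Q.
move: (l2sum _ _ _) (l2sum _ _ _) => A B.
move: (p x) (p y) (q x) (q y) => a b c d CS a0 b0 c0 d0 Q0 P0 Qle Ple.
have : P ^+ 2 <= (a + b) ^+ 2 by rewrite ler_pXn2r ?nnegrE ?addr_ge0.
have : Q ^+ 2 <= (c + d) ^+ 2 by rewrite ler_pXn2r ?nnegrE ?addr_ge0.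
rewrite !expr2 in CS *; clear -CS; move: (A * B) CS => AB CS HQ HP; lra.
Qed.

Definition defect p x y : R :=
  p x ^+ 2 / 2 + p y ^+ 2 / 2 - p (2^-1 *: (x + y)) ^+ 2.

Lemma defect_l2sum p q x y : defect (l2sum p q) x y = defect p x y + defect q x y.
Proof. by rewrite /defect !l2sum_sqr; ring. Qed.

Lemma defect_scale p (c : R) x y :
  defect (fun z => c * p z) x y = c ^+ 2 * defect p x y.
Proof. by rewrite /defect !exprMn; ring. Qed.

Lemma defect_functional (g : X -> R) x y : functional g ->
  defect (fun z => `|g z|) x y = (g (y - x) / 2) ^+ 2.
Proof.
move=> gl; rewrite /defect !real_normK ?num_real//.
rewrite (functionalZ _ _ gl) (functionalD _ _ gl) (functionalB _ _ gl).
by field.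
Qed.

Lemma seminorm_mid p x y : seminorm p -> p (2^-1 *: (x + y)) <= (p x + p y) / 2.
Proof.
move=> sp; rewrite (seminormZ _ sp) ?invr_ge0// mulrC ler_pM2r ?invr_gt0//.
exact: sp.1.
Qed.

Lemma defect_ge p x y : seminorm p -> ((p x - p y) / 2) ^+ 2 <= defect p x y.
Proof.
move=> sp; have pm := seminorm_mid x y sp.
have p0 := seminorm_ge0 (2^-1 *: (x + y)) sp.
have : p (2^-1 *: (x + y)) ^+ 2 <= ((p x + p y) / 2) ^+ 2.
  by rewrite ler_pXn2r ?nnegrE//; apply: le_trans pm.
rewrite /defect; lra.
Qed.

Lemma defect_ge0 p x y : seminorm p -> 0 <= defect p x y.
Proof. by move=> sp; apply: le_trans (defect_ge x y sp); exact: sqr_ge0. Qed.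

(** A defect at most [s ^+ 2] forces the two values to differ by at most
    [2 * s], and the value at the midpoint to be nearly the larger one.  This
    is how a statement on the defect is normalised to one on the unit ball. *)
Lemma defect_small p x y (s : R) : seminorm p -> 0 <= s ->
  defect p x y <= s ^+ 2 ->
  [/\ `|p x - p y| <= 2 * s & Num.max (p x) (p y) - 2 * s <= p (2^-1 *: (x + y))].
Proof.
move=> sp s0 ds.
have xys : `|p x - p y| <= 2 * s.
  have := le_trans (defect_ge x y sp) ds.
  rewrite -[_ ^+ 2]real_normK ?num_real// ler_pXn2r ?nnegrE//.
  by rewrite normrM (ger0_norm (x := 2^-1)) ?invr_ge0//; lra.
split=> //.
have p0 := seminorm_ge0 (2^-1 *: (x + y)) sp.
have px0 := seminorm_ge0 x sp; have py0 := seminorm_ge0 y sp.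
move: xys ds p0 px0 py0; rewrite /defect ler_norml => /andP[].
move: (p (_ *: _)) (p x) (p y) => m a b h1 h2 ds m0 a0 b0.
rewrite leNgt; apply/negP => mlt.
wlog ab : a b h1 h2 ds a0 b0 mlt / b <= a.
  move=> H; have [ba|ab] := leP b a; first exact: (H a b).
  by apply: (H b a) => //; rewrite 1?maxC//; lra.
have Mab : Num.max a b = a by apply/max_idPl.
rewrite Mab in mlt.
have : m ^+ 2 < (a - 2 * s) ^+ 2 by rewrite ltr_pXn2r ?nnegrE//; lra.
have : (a - 2 * s) ^+ 2 <= b ^+ 2 by rewrite ler_pXn2r ?nnegrE//; lra.
have : s * (2 * s) <= s * a by rewrite ler_wpM2l//; lra.
by have := sqr_ge0 s; rewrite !expr2; lra.
Qed.

End Seminorms.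

(** * Suprema and iterated l2-sums of seminorms *)

Section Suprema.
Context (R : realType) (X : lmodType R).

Definition fsup (I : Type) (F : I -> X -> R) (x : X) : R :=
  sup (range (fun i => F i x)).

Section Bounded.
Context (I : Type) (i0 : I) (F : I -> X -> R) (B : X -> R).
Hypothesis FB : forall i x, F i x <= B x.

Lemma fsup_ge i x : F i x <= fsup F x.
Proof.
apply: ub_le_sup; last by exists i.
by exists (B x) => _ [j _ <-].
Qed.

Lemma fsup_le (c : R) x : (forall i, F i x <= c) -> fsup F x <= c.
Proof. by move=> Fc; apply: ge_sup; [exists (F i0 x), i0|move=> _ [j _ <-]]. Qed.

Lemma fsup_adherent (e : R) x : 0 < e -> exists i, fsup F x - e < F i x.
Proof.
move=> e0; have [||_ [i _ <-] He] := @sup_adherent R (range (fun i => F i x)) e.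
- by [].
- by split; [exists (F i0 x), i0|exists (B x) => _ [j _ <-]].
- by exists i.
Qed.

Lemma seminorm_fsup : (forall i, seminorm (F i)) -> seminorm (fsup F).
Proof.
move=> sF.
have le (a : R) x : fsup F (a *: x) <= `|a| * fsup F x.
  by apply: fsup_le => i; rewrite (sF i).2 ler_wpM2l// fsup_ge.
split=> [x y|a x].
  apply: fsup_le => i; apply: le_trans ((sF i).1 x y) _.
  by apply: lerD; exact: fsup_ge.
apply/eqP; rewrite eq_le le /=.
have [->|a0] := eqVneq a 0.
  by rewrite normr0 mul0r; apply: le_trans (fsup_ge i0 _); exact: seminorm_ge0.
have := le a^-1 (a *: x); rewrite scalerA mulVf// scale1r normfV.
by rewrite mulrC ler_pdivlMr ?normr_gt0// mulrC.
Qed.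

End Bounded.

Implicit Types (p : nat -> X -> R).

Fixpoint l2iter p n : X -> R :=
  if n is m.+1 then l2sum (l2iter p m) (p m) else fun=> 0.

Lemma seminorm_l2iter p n : (forall j, seminorm (p j)) -> seminorm (l2iter p n).
Proof.
by move=> sp; elim: n => [|n IH]; [exact: seminorm_zero|exact: seminorm_l2sum].
Qed.

Lemma defect_l2iter p n j x y : (forall i, seminorm (p i)) -> (j < n)%N ->
  defect (p j) x y <= defect (l2iter p n) x y.
Proof.
move=> sp; elim: n => // n IH; rewrite ltnS leq_eqVlt /= defect_l2sum.
move=> /predU1P[->|/IH jn].
  by rewrite lerDr; apply: defect_ge0; exact: seminorm_l2iter.
by apply: (le_trans jn); rewrite lerDl; exact: defect_ge0.
Qed.

Lemma eq_l2iter p n x y : (forall j, (j < n)%N -> p j x = p j y) ->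
  l2iter p n x = l2iter p n y.
Proof.
elim: n => // n IH pxy /=; rewrite /l2sum pxy// IH// => j jn.
by apply: pxy; rewrite ltnS ltnW.
Qed.

Lemma l2iter_geometric p n (c : R) x : 0 <= c ->
  (forall j, 0 <= p j x <= 2^-1 ^+ j * c) -> l2iter p n x ^+ 2 <= 2 * c ^+ 2.
Proof.
move=> c0 pc.
have H : l2iter p n x ^+ 2 <= 2 * c ^+ 2 * (1 - 4^-1 ^+ n).
  elim: n => [|n IH] /=; first by rewrite expr0 subrr mulr0 expr0n.
  rewrite l2sum_sqr (exprSr 4^-1).
  have : p n x ^+ 2 <= 4^-1 ^+ n * c ^+ 2.
    have -> : 4^-1 = 2^-1 ^+ 2 :> R by rewrite exprVn -natrX.
    have /andP[p0 pn] := pc n.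
    by rewrite exprAC -exprMn ler_pXn2r ?nnegrE// mulr_ge0// exprn_ge0.
  have : 0 <= 4^-1 ^+ n * c ^+ 2 by rewrite mulr_ge0 ?exprn_ge0.
  by move: IH; move: (4^-1 ^+ n) (c ^+ 2) (p n x ^+ 2) => t *; lra.
by apply: (le_trans H); rewrite ler_piMr ?mulr_ge0 ?sqr_ge0// gerBl exprn_ge0.
Qed.

End Suprema.

(** * Rotundity in terms of the defect *)

Section Rotundity.
Context (R : realType) (X : normedModType R).
Implicit Types (N p q : X -> R) (x y v : X).

Lemma is_norm_seminorm N : is_norm N -> seminorm N.
Proof. by move=> [ND NZ _]; split. Qed.

Lemma cvg_to1 (u : nat -> R) :
  (forall n, 1 - n.+1%:R^-1 <= u n <= 1) -> u n @[n --> \oo] --> (1 : R).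
Proof.
move=> Hu.
apply: (@squeeze_cvgr _ _ _ _ (fun n : nat => 1 - n.+1%:R^-1) (fun=> 1)).
- by near=> n; exact: Hu.
- rewrite -[X in _ --> X]subr0; apply: cvgB; first exact: cvg_cst.
  exact: cvg_harmonic.
- exact: cvg_cst.
Unshelve. all: by end_near. Qed.

(** Contraposition: counterexamples for [t = n.+1%:R^-1] form sequences that
    violate URED. *)
Lemma URED_modulus N v (e : R) : is_norm N -> URED N -> N v = 1 -> 0 < e ->
  exists2 t : R, 0 < t & forall x (l : R), N x <= 1 -> N (x + l *: v) <= 1 ->
    1 - t <= N (2^-1 *: (x + (x + l *: v))) -> `|l| <= e.
Proof.
move=> /is_norm_seminorm sN uN Nv e0; apply: contrapT => H.
have /choice[s Hs] : forall n : nat, exists s : X * R,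
    [/\ N s.1 <= 1, N (s.1 + s.2 *: v) <= 1,
     1 - n.+1%:R^-1 <= N (2^-1 *: (s.1 + (s.1 + s.2 *: v))) & e < `|s.2|].
  move=> n; apply: contrapT => Hn; apply: H; exists n.+1%:R^-1.
    by rewrite invr_gt0.
  move=> x l Nx Ny Nm; rewrite leNgt; apply/negP => el.
  by apply: Hn; exists (x, l).
have : (s n).2 @[n --> \oo] --> (0 : R).
  apply: (uN v Nv (fun n => (s n).1) (fun n => (s n).1 + (s n).2 *: v)).
- by move=> n; have [] := Hs n.
- by move=> n; have [] := Hs n.
- by move=> n; rewrite addrAC subrr add0r.
- apply: cvg_to1 => n; have [N1 N2 -> _] := Hs n; rewrite andTb.
  by apply: (le_trans (seminorm_mid _ _ sN)); rewrite ler_pdivrMr// mul1r; lra.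
move=> /cvgrPdist_lt/(_ e e0)[n _ /(_ n (leqnn n))] /=.
by rewrite sub0r normrN; have [_ _ _ +] := Hs n => /lt_trans h /h; rewrite ltxx.
Qed.

Lemma LUR_modulus N x (e : R) : is_norm N -> LUR N -> N x = 1 -> 0 < e ->
  exists2 t : R, 0 < t & forall y, N y <= 1 ->
    1 - t <= N (2^-1 *: (x + y)) -> N (x - y) <= e.
Proof.
move=> /is_norm_seminorm sN lN Nx e0; apply: contrapT => H.
have /choice[s Hs] : forall n : nat, exists y,
    [/\ N y <= 1, 1 - n.+1%:R^-1 <= N (2^-1 *: (x + y)) & e < N (x - y)].
  move=> n; apply: contrapT => Hn; apply: H; exists n.+1%:R^-1.
    by rewrite invr_gt0.
  move=> y Ny Nm; rewrite leNgt; apply/negP => el.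
  by apply: Hn; exists y.
have : N (x - s n) @[n --> \oo] --> (0 : R).
  apply: (lN x Nx s).
- by move=> n; have [] := Hs n.
- apply: cvg_to1 => n; have [N1 -> _] := Hs n; rewrite andTb.
  by apply: (le_trans (seminorm_mid _ _ sN)); rewrite Nx ler_pdivrMr// mul1r; lra.
move=> /cvgrPdist_lt/(_ e e0)[n _ /(_ n (leqnn n))] /=.
rewrite sub0r normrN ger0_norm ?seminorm_ge0//.
by have [_ _ +] := Hs n => /lt_trans h /h; rewrite ltxx.
Qed.

End Rotundity.

Section DefectModuli.
Context (R : realType) (X : normedModType R).
Implicit Types (N p q V : X -> R) (x y v : X).

(** Sequence-free forms of URED and LUR, without normalisation to the unit
    ball.  They make sense for seminorms, survive l2-sums, and only
    mention the ambient norm, so that they can be compared across pieces. *)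
Definition defect_URED V : Prop :=
  forall v, v != 0 -> forall r e : R, 0 < r -> 0 < e ->
  exists2 t : R, 0 < t & forall x (l : R), `|x| <= r -> `|x + l *: v| <= r ->
    defect V x (x + l *: v) <= t -> `|l| <= e.

Definition defect_LUR V : Prop :=
  forall x, x != 0 -> forall e : R, 0 < e ->
  exists2 t : R, 0 < t & forall y, defect V x y <= t -> `|x - y| <= e.

Lemma equivalent_norm_gt0 N x : equivalent_norm N -> x != 0 -> 0 < N x.
Proof.
move=> [_ [c [C [c0 C0 NE]]]] x0; apply: lt_le_trans (NE x).1.
by rewrite mulr_gt0// normr_gt0.
Qed.

Lemma functional_continuous (f : X -> R) N (K : R) :
  functional f -> equivalent_norm N -> 0 < K -> (forall x, `|f x| <= K * N x) ->
  exists F : {linear X -> R^o},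
    continuous (F : X -> R^o) /\ forall x, F x = f x.
Proof.
move=> fl [_ [c [C [c0 C0 NE]]]] K0 fN.
pose F : {linear X -> R^o} := HB.pack (f : X -> R^o)
  (GRing.isLinear.Build R X R^o _ (f : X -> R^o) fl).
exists F; split=> // x.
apply/cvgrPdist_le => a a0; near=> y.
suff : `|f x - f y| <= a by [].
rewrite -(functionalB _ _ fl); apply: (le_trans (fN _)).
rewrite -ler_pdivlMl//; apply: (le_trans (NE _).2).
rewrite -ler_pdivlMl//.
near: y; apply: cvgr_dist_le; first exact: cvg_id.
by rewrite !mulr_gt0// ?invr_gt0.
Unshelve. all: by end_near. Qed.

(** Two points at distance [`|l| > e] along [v] have norms whose maximum [m] is
    at least [m0]; dividing by [m] brings them to the unit ball. *)
Lemma URED_defect N : equivalent_norm N -> URED N -> defect_URED N.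
Proof.
move=> eN uN v v0 r e r0 e0.
have nN := eN.1; have sN := is_norm_seminorm nN.
have Nv0 := equivalent_norm_gt0 eN v0.
have [_ [c [C [c0 C0 NE]]]] := eN.
pose v' := (N v)^-1 *: v.
have Nv' : N v' = 1 by rewrite sN.2 gtr0_norm ?invr_gt0// mulVf ?gt_eqF.
have Cr0 : 0 < C * r by rewrite mulr_gt0.
have e'0 : 0 < e * N v / (2 * (C * r)) by rewrite divr_gt0 ?mulr_gt0.
have [t t0 Ht] := URED_modulus nN uN Nv' e'0.
pose m0 := e * N v / 2; have m00 : 0 < m0 by rewrite divr_gt0 ?mulr_gt0.
pose s := t * m0 / 2; have s0 : 0 < s by rewrite divr_gt0 ?mulr_gt0.
exists (s ^+ 2); first exact: exprn_gt0.
move=> x l xr yr ds; rewrite leNgt; apply/negP => el.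
have [_ mid] := defect_small sN (ltW s0) ds.
set y := x + l *: v in yr ds mid *.
pose m := Num.max (N x) (N y); rewrite -/m in mid.
have xm : N x <= m by rewrite le_max lexx.
have ym : N y <= m by rewrite le_max lexx orbT.
have m0m : m0 < m.
  have : N (l *: v) <= N y + N x.
    by rewrite (_ : l *: v = y - x) ?seminormB// /y addrAC subrr add0r.
  rewrite sN.2; have : e * N v < `|l| * N v by rewrite ltr_pM2r.
  by rewrite /m0; lra.
have mCr : m <= C * r.
  rewrite ge_max; apply/andP; split; apply: (le_trans (NE _).2).
    by rewrite ler_pM2l.
  by rewrite ler_pM2l.
have mp : 0 < m by exact: lt_trans m0m.
have NM z : N (m^-1 *: z) = N z / m.
  by rewrite sN.2 gtr0_norm ?invr_gt0// mulrC.
have yE : m^-1 *: x + (l * N v / m) *: v' = m^-1 *: y.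
  rewrite /y scalerDr !scalerA; congr (_ + _ *: _).
  by field; rewrite !gt_eqF.
have := Ht (m^-1 *: x) (l * N v / m).
rewrite yE -scalerDr scalerA [2^-1 * _]mulrC -scalerA !NM.
rewrite !ler_pdivrMr// !mul1r => /(_ xm ym).
have -> : 1 - t <= N (2^-1 *: (x + y)) / m.
  rewrite ler_pdivlMr//; apply: le_trans mid.
  have : t * m0 <= t * m by rewrite ler_pM2l// ltW.
  by rewrite /s; lra.
move=> /(_ isT); rewrite !normrM normfV (gtr0_norm mp) (gtr0_norm Nv0).
rewrite leNgt => /negP; apply.
have lNm : `|l| * N v / (2 * (C * r)) < `|l| * N v / m.
  rewrite ltr_pM2l ?mulr_gt0 ?(lt_trans e0 el)//.
  by rewrite ltf_pV2 ?posrE ?mulr_gt0//; lra.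
apply: lt_trans lNm; rewrite ltr_pM2r ?invr_gt0 ?mulr_gt0//.
by rewrite ltr_pM2r.
Qed.

(** Here [x / c] is on the sphere but [y] must be divided by
    [m = Num.max c (N y)], which is close to [c] when the defect is small. *)
Lemma LUR_defect N : equivalent_norm N -> LUR N -> defect_LUR N.
Proof.
move=> eN lN x x0 e e0.
have nN := eN.1; have sN := is_norm_seminorm nN.
have c0 := equivalent_norm_gt0 eN x0.
have [_ [k [C [k0 C0 NE]]]] := eN.
set c := N x in c0.
pose x' := c^-1 *: x.
have Nx' : N x' = 1 by rewrite sN.2 gtr0_norm ?invr_gt0// mulVf ?gt_eqF.
have ke0 : 0 < k * e by rewrite mulr_gt0.
have e'0 : 0 < k * e / (4 * c) by rewrite divr_gt0 ?mulr_gt0.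
have [t t0 Ht] := LUR_modulus nN lN Nx' e'0.
pose s := Num.min (t * c / 3) (Num.min (c / 2) (k * e / 4)).
have s0 : 0 < s.
  by rewrite !lt_min !divr_gt0// mulr_gt0.
have s1 : s <= t * c / 3 by rewrite ge_min lexx.
have s2 : s <= c / 2 by rewrite !ge_min lexx orbT.
have s3 : s <= k * e / 4 by rewrite !ge_min lexx !orbT.
exists (s ^+ 2); first exact: exprn_gt0.
move=> y ds; have [cy mid] := defect_small sN (ltW s0) ds.
pose m := Num.max c (N y); rewrite -/c -/m in mid cy.
have cm : c <= m by rewrite le_max lexx.
have ym : N y <= m by rewrite le_max lexx orbT.
have mc : m <= c + 2 * s.
  by move: cy; rewrite ler_norml ge_max => /andP[? ?]; apply/andP; split; lra.
have mp : 0 < m by exact: lt_le_trans cm.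
have xE : x = c *: x' by rewrite scalerA divff ?gt_eqF// scale1r.
pose y' := m^-1 *: y.
have yE : y = m *: y' by rewrite scalerA divff ?gt_eqF// scale1r.
have Ny' : N y' <= 1 by rewrite sN.2 gtr0_norm ?invr_gt0// mulrC ler_pdivrMr// mul1r.
have mx : N ((m - c) *: x') <= 2 * s.
  by rewrite sN.2 Nx' mulr1 ger0_norm; lra.
have NxB : N (x - y) <= m * N (x' - y') + 2 * s.
  have -> : x - y = m *: (x' - y') - (m - c) *: x'.
    by rewrite {1}xE {1}yE scalerBl scalerBr opprB [RHS]addrC addrA subrK.
  apply: (le_trans (seminormB _ _ sN)); apply: lerD => //.
  by rewrite (seminormZ _ sN)// ltW.
have mid' : 1 - t <= N (2^-1 *: (x' + y')).
  have : N (2^-1 *: (x + y)) <= m * N (2^-1 *: (x' + y')) + s.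
    have -> : 2^-1 *: (x + y) =
        m *: (2^-1 *: (x' + y')) - 2^-1 *: ((m - c) *: x').
      rewrite scalerA [m * _]mulrC -scalerA -scalerBr {1}xE {1}yE.
      congr (_ *: _).
      by rewrite scalerBl scalerDr opprB [RHS]addrC addrA subrK.
    apply: (le_trans (seminormB _ _ sN)); rewrite (seminormZ _ sN) ?(ltW mp)//.
    by apply: lerD => //; rewrite (seminormZ _ sN)//; lra.
  have : t * c <= t * m by rewrite ler_pM2l.
  by move=> tcm Nm; rewrite -(ler_pM2l mp); lra.
have := NE (x - y) => -[+ _] => kN.
have := Ht _ Ny' mid'.
rewrite ler_pdivlMr ?mulr_gt0// => xy'.
rewrite -(ler_pM2l k0); apply: (le_trans kN); apply: (le_trans NxB).
have : m * N (x' - y') <= (2 * c) * N (x' - y').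
  by rewrite ler_wpM2r ?seminorm_ge0//; lra.
lra.
Qed.

Lemma URED_of_modulus N : is_norm N ->
  (forall v, v != 0 -> forall e : R, 0 < e -> exists2 t : R, 0 < t &
     forall x (l : R), N x <= 1 -> N (x + l *: v) <= 1 ->
     1 - t <= N (2^-1 *: (x + (x + l *: v))) -> `|l| <= e) ->
  URED N.
Proof.
move=> nN H v Nv x y l Nx Ny xyl Nm.
have v0 : v != 0.
  apply/eqP => v0; move: Nv; rewrite /unit_sphere/= v0.
  by rewrite (seminorm0 (is_norm_seminorm nN)) => /eqP; rewrite eq_sym oner_eq0.
apply/cvgrPdist_le => e e0; have [t t0 Ht] := H v v0 e e0.
move/cvgrPdist_le : Nm => /(_ t t0); apply: filterS => n.
rewrite ler_norml sub0r normrN => /andP[_ Nt].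
have yE : y n = x n + l n *: v by rewrite -xyl addrC subrK.
apply: (Ht (x n)); [exact: Nx|rewrite -yE; exact: Ny|rewrite -yE].
by move: Nt; lra.
Qed.

Lemma LUR_of_modulus N : is_norm N ->
  (forall x, N x = 1 -> forall e : R, 0 < e -> exists2 t : R, 0 < t &
     forall y, N y <= 1 -> 1 - t <= N (2^-1 *: (x + y)) -> N (x - y) <= e) ->
  LUR N.
Proof.
move=> nN H x Nx y Ny Nm.
apply/cvgrPdist_le => e e0; have [t t0 Ht] := H x Nx e e0.
move/cvgrPdist_le : Nm => /(_ t t0); apply: filterS => n.
rewrite ler_norml sub0r normrN => /andP[_ Nt].
rewrite ger0_norm ?(seminorm_ge0 _ (is_norm_seminorm nN))//.
by apply: Ht; [exact: Ny|lra].
Qed.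

End DefectModuli.

(** * The new norm *)

Section Construction.
(* The parameter [s] is the height of the roofs: the new norm is between [M]
   and [(1 + 24 * s) * M].  The slab cuts the ball of [M] at depth about [8 * s], so that
   a move by [4 * s] in any direction from the middle of its face stays in this
   ball. *)
Context (R : realType) (X : normedModType R).
Variables (M V : X -> R) (u e : X) (g f : X -> R) (w : nat -> X)
  (h : nat -> X -> R) (K s : R).
Hypothesis eM : equivalent_norm M.
Hypothesis sV : seminorm V.
Hypothesis VK : forall x, V x <= K * M x.
Hypothesis K0 : 0 < K.
Hypothesis s0 : 0 < s.
Hypothesis s64 : s <= 64^-1.
Hypothesis fr : frame M u e g f w h.

Definition flat_dir n : X := e + w n.+1.

(** The projection along [flat_dir n] onto the kernel of [h n.+1]. *)
Definition collapse n (x : X) : X := x - h n.+1 x *: flat_dir n.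

(** Two distinct [h i], [h j] cannot both exceed half of this seminorm at a
    point: this is what separates the roofs. *)
Definition pair_sup : X -> R :=
  fsup (fun (ij : nat * nat) x =>
          if ij.1 == ij.2 then 0 else `|h ij.1 x| + `|h ij.2 x|).

(** Square summable weights, so that all [h j] enter one l2-sum. *)
Definition weighted (j : nat) (x : X) : R := 2^-1 ^+ j * `|h j x|.

Definition rate (n : nat) : R := n.+1%:R^-1.

(** The parts of the pieces that decide the shape of the ball: the base piece at
    index 0, the roof of index [n] at index [n.+1].  The summand
    [s ^+ 2 / 8 * M x] makes the gap between the base and the lower
    roofs proportional to [M x]. *)
Definition shape i : X -> R :=
  if i is n.+1 then fun x => (1 + 8 * s) * (`|g x| + s * `|h n x|)
  else fun x => Num.max (M x)
    ((1 + 8 * s) * (`|g x| + 3 / 4 * (s * pair_sup x)) + s ^+ 2 / 8 * M x).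

(** The parts of the pieces that make them rotund.  That of the roof of index [n]
    varies along [flat_dir n] only through its last summand, of size [rate n]. *)
Definition rotund i : X -> R :=
  if i is n.+1 then
    l2sum (fun x => V (collapse n x))
          (l2sum (l2iter weighted n.+1) (fun x => rate n * V x))
  else V.

Definition rotund_cst : R := 50 * K ^+ 2 + 18.

(** Chosen so small ([weight_sqr]) that the rotund parts change neither the
    gap between the roofs nor the place where each roof dominates. *)
Definition weight : R := Num.sqrt (s ^+ 2 / 32 / rotund_cst).

Definition piece i : X -> R := l2sum (shape i) (fun x => weight * rotund i x).

Definition new_norm : X -> R := fsup piece.

Let sM : seminorm M. Proof. exact: is_norm_seminorm eM.1. Qed.

Let M0 x : 0 <= M x. Proof. exact: seminorm_ge0. Qed.
Let hl n := frame_h fr n.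

Lemma flat_dir_le n : M (flat_dir n) <= 2.
Proof.
by apply: (le_trans (sM.1 _ _)); rewrite (frame_Ne fr) (frame_Nw fr).
Qed.

Lemma collapse_linear n (a : R) x y :
  collapse n (a *: x + y) = a *: collapse n x + collapse n y.
Proof.
by rewrite /collapse hl scalerDl scalerBr scalerA addrACA opprD.
Qed.

Lemma collapse_le n x : M (collapse n x) <= 7 * M x.
Proof.
apply: (le_trans (seminormB _ _ sM)); rewrite sM.2.
have := ler_pM (normr_ge0 _) (M0 _) (frame_hN fr n.+1 x) (flat_dir_le n); lra.
Qed.

Lemma collapse_fixed n v : h n.+1 v = 0 -> collapse n v = v.
Proof. by move=> hv; rewrite /collapse hv scale0r subr0. Qed.

Lemma h_flat_dir k n : h k (flat_dir n) = h k (w n.+1).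
Proof. by rewrite (functionalD _ _ (hl k)) (frame_he fr) add0r. Qed.

Lemma collapse_flat_dir n : collapse n (flat_dir n) = 0.
Proof. by rewrite /collapse h_flat_dir (frame_hw_diag fr) scale1r subrr. Qed.

Lemma h_w_neq k n : k != n -> `|h k (w n)| <= 8^-1.
Proof.
case: ltngtP => // kn _; last exact: (frame_hw_gt fr).
by rewrite (frame_hw_lt fr) // normr0.
Qed.

Lemma h_w_le1 k n : `|h k (w n)| <= 1.
Proof.
have [->|/h_w_neq] := eqVneq k n; first by rewrite (frame_hw_diag fr) normr1.
by move=> /le_trans; apply; lra.
Qed.

Let pair_bound (ij : nat * nat) x :
  (if ij.1 == ij.2 then 0 else `|h ij.1 x| + `|h ij.2 x|) <= 6 * M x.
Proof.
case: ifP => _; first by rewrite mulr_ge0.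
by have := frame_hN fr ij.1 x; have := frame_hN fr ij.2 x; lra.
Qed.

Lemma pair_sup_le x : pair_sup x <= 6 * M x.
Proof. by apply: fsup_le => [|ij]; [exact: (0, 0)%N|exact: pair_bound]. Qed.

Lemma pair_sup_ge i j x : i != j -> `|h i x| + `|h j x| <= pair_sup x.
Proof.
by move=> ij; have := fsup_ge pair_bound (i, j) x; rewrite /= (negPf ij).
Qed.

Lemma seminorm_pair_sup : seminorm pair_sup.
Proof.
apply: (seminorm_fsup (0, 0)%N pair_bound) => -[i j] /=.
case: (i == j); first exact: seminorm_zero.
by apply: seminorm_add; apply: seminorm_functional.
Qed.

Lemma pair_sup_ge0 x : 0 <= pair_sup x.
Proof. exact: seminorm_ge0 seminorm_pair_sup. Qed.

(** An index whose value exceeds half of [pair_sup x] is the only such one. *)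
Lemma pair_sup_half x : exists n0, forall n, n != n0 -> `|h n x| <= pair_sup x / 2.
Proof.
have [[n0 Hn0]|H] := pselect (exists n0, pair_sup x / 2 < `|h n0 x|).
  by exists n0 => n /(pair_sup_ge x); move: Hn0; lra.
by exists 0%N => n _; rewrite leNgt; apply/negP => Hn; apply: H; exists n.
Qed.

Let s2 : s ^+ 2 <= s / 64.
Proof. by rewrite expr2 ler_pM2l. Qed.

Let s20 : 0 < s ^+ 2. Proof. exact: exprn_gt0. Qed.

Let c8 : 0 <= 1 + 8 * s.
Proof. by rewrite addr_ge0// mulr_ge0// ltW. Qed.

Lemma seminorm_shape i : seminorm (shape i).
Proof.
have sg := seminorm_functional (frame_g fr).
case: i => [|n] /=.
  apply: seminorm_max => //; apply: seminorm_add; apply: seminorm_scale => //.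
  - apply: seminorm_add => //; apply: seminorm_scale; first lra.
    by apply: seminorm_scale; [exact: ltW|exact: seminorm_pair_sup].
  - by rewrite divr_ge0// ltW.
apply: seminorm_scale => //; apply: seminorm_add => //.
by apply: seminorm_scale; [exact: ltW|exact: seminorm_functional].
Qed.

Lemma shape_le i x : shape i x <= (1 + 16 * s) * M x.
Proof.
have gM := frame_gN fr x; have Mx := M0 x.
have e1 := c8.
have e2M : s ^+ 2 * M x <= s / 64 * M x by rewrite ler_wpM2r.
have sMx : 0 <= s * M x by rewrite mulr_ge0// ltW.
case: i => [|n] /=.
  rewrite ge_max; apply/andP; split; first lra.
  have : s * pair_sup x <= s * (6 * M x).
    by rewrite ler_wpM2l ?pair_sup_le// ltW.
  move=> eq; have : `|g x| + 3 / 4 * (s * pair_sup x) <= (1 + 9 / 2 * s) * M x.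
    lra.
  move=> /(ler_wpM2l e1); rewrite expr2 in e2M *; lra.
have : s * `|h n x| <= s * (3 * M x).
  by rewrite ler_wpM2l ?(frame_hN fr)// ltW.
move=> eh; have : `|g x| + s * `|h n x| <= (1 + 3 * s) * M x by lra.
move=> /(ler_wpM2l e1); rewrite expr2 in e2M *; lra.
Qed.

Lemma rate_gt0 n : 0 < rate n. Proof. by rewrite invr_gt0. Qed.

Lemma rate_le1 n : rate n <= 1.
Proof. by rewrite invf_le1// ler1n. Qed.

Lemma seminorm_weighted j : seminorm (weighted j).
Proof.
by apply: seminorm_scale; [rewrite exprn_ge0|exact: seminorm_functional].
Qed.

Lemma rotundS n : rotund n.+1 = l2sum (fun x => V (collapse n x))
  (l2sum (l2iter weighted n.+1) (fun x => rate n * V x)).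
Proof. by []. Qed.

Lemma rotund_sqrS n x : rotund n.+1 x ^+ 2 = V (collapse n x) ^+ 2 +
  (l2iter weighted n.+1 x ^+ 2 + (rate n * V x) ^+ 2).
Proof. by rewrite rotundS 2!l2sum_sqr. Qed.

Lemma piece_sqr i x : piece i x ^+ 2 = shape i x ^+ 2 + (weight * rotund i x) ^+ 2.
Proof. exact: l2sum_sqr. Qed.

Lemma seminorm_rotund i : seminorm (rotund i).
Proof.
case: i => [//|n] /=; apply: seminorm_l2sum.
  by apply: seminorm_comp => //; exact: collapse_linear.
apply: seminorm_l2sum.
  exact: (@seminorm_l2iter _ _ weighted n.+1 seminorm_weighted).
by apply: seminorm_scale => //; exact: ltW (rate_gt0 n).
Qed.

Let V2 x : V x ^+ 2 <= K ^+ 2 * M x ^+ 2.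
Proof.
rewrite -exprMn ler_pXn2r ?nnegrE//; first exact: seminorm_ge0.
by rewrite mulr_ge0// ltW.
Qed.

Lemma rotund_le i x : rotund i x ^+ 2 <= rotund_cst * M x ^+ 2.
Proof.
have M2 := sqr_ge0 (M x); have V2x := V2 x.
have KM : 0 <= K ^+ 2 * M x ^+ 2 by rewrite mulr_ge0// exprn_ge0// ltW.
rewrite /rotund_cst; case: i => [|n]; first by rewrite /rotund; lra.
rewrite rotund_sqrS.
have : V (collapse n x) ^+ 2 <= 49 * (K ^+ 2 * M x ^+ 2).
  apply: (le_trans (V2 _)); rewrite [leRHS]mulrCA ler_wpM2l ?exprn_ge0 ?(ltW K0)//.
  have -> : 49 = 7 ^+ 2 :> R by ring.
  by rewrite -exprMn ler_pXn2r ?nnegrE ?mulr_ge0// collapse_le.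
have : l2iter weighted n.+1 x ^+ 2 <= 2 * (3 * M x) ^+ 2.
  apply: l2iter_geometric; first by rewrite mulr_ge0.
  move=> j; rewrite mulr_ge0 ?exprn_ge0//= ler_wpM2l ?exprn_ge0//.
  exact: (frame_hN fr).
have : (rate n * V x) ^+ 2 <= V x ^+ 2.
  rewrite ler_pXn2r ?nnegrE ?mulr_ge0 ?(ltW (rate_gt0 _)) ?(seminorm_ge0 _ sV)//.
  by rewrite ler_piMl ?rate_le1// seminorm_ge0.
rewrite (exprMn _ 3); lra.
Qed.

Let cst0 : 0 < rotund_cst.
Proof. by rewrite /rotund_cst addr_gt0// mulr_gt0// exprn_gt0. Qed.

Let weight_arg_gt0 : 0 < s ^+ 2 / 32 / rotund_cst.
Proof.
by apply: divr_gt0 cst0; apply: divr_gt0 s20 _.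
Qed.

Lemma weight_gt0 : 0 < weight.
Proof. by rewrite sqrtr_gt0; exact: weight_arg_gt0. Qed.

Lemma weight_sqr : weight ^+ 2 * rotund_cst = s ^+ 2 / 32.
Proof.
rewrite sqr_sqrtr; last exact: ltW weight_arg_gt0.
by rewrite divfK// gt_eqF.
Qed.

Lemma weighted_rotund_le i x :
  (weight * rotund i x) ^+ 2 <= s ^+ 2 / 32 * M x ^+ 2.
Proof.
rewrite exprMn -weight_sqr -mulrA ler_wpM2l ?exprn_ge0 ?(ltW weight_gt0)//.
exact: rotund_le.
Qed.

Lemma seminorm_piece i : seminorm (piece i).
Proof.
apply: seminorm_l2sum; first exact: seminorm_shape.
by apply: seminorm_scale; [exact: ltW weight_gt0|exact: seminorm_rotund].
Qed.

Lemma piece_le i x : piece i x <= (1 + 24 * s) * M x.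
Proof.
have e30 : 0 <= (1 + 24 * s) * M x.
  by rewrite mulr_ge0// addr_ge0// mulr_ge0// ltW.
rewrite -(ler_pXn2r (n := 2)) ?nnegrE ?l2sum_ge0// l2sum_sqr.
have := weighted_rotund_le i x.
have : shape i x ^+ 2 <= ((1 + 16 * s) * M x) ^+ 2.
  rewrite ler_pXn2r ?nnegrE ?shape_le//; first exact/seminorm_ge0/seminorm_shape.
  by rewrite mulr_ge0// addr_ge0// mulr_ge0// ltW.
have : 0 <= s ^+ 2 * M x ^+ 2 by rewrite mulr_ge0 ?sqr_ge0.
have : 0 <= s * M x ^+ 2 by rewrite mulr_ge0 ?sqr_ge0// ltW.
rewrite !exprMn; move: (M x ^+ 2) => m.
by rewrite !expr2; lra.
Qed.

Lemma piece0_ge x : M x <= piece 0 x.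
Proof.
rewrite -(ler_pXn2r (n := 2)) ?nnegrE ?l2sum_ge0// l2sum_sqr.
apply: ler_wpDr; first exact: sqr_ge0.
by rewrite ler_pXn2r ?nnegrE ?M0 ?(seminorm_ge0 _ (seminorm_shape 0))//= le_max lexx.
Qed.

Lemma piece_new_norm i x : piece i x <= new_norm x.
Proof. exact: (fsup_ge piece_le). Qed.

Lemma seminorm_new_norm : seminorm new_norm.
Proof. exact: (seminorm_fsup 0%N piece_le seminorm_piece). Qed.

Lemma new_norm_ge x : M x <= new_norm x.
Proof. exact: le_trans (piece0_ge x) (piece_new_norm 0 x). Qed.

Lemma new_norm_le x : new_norm x <= (1 + 24 * s) * M x.
Proof. by apply: (fsup_le 0%N) => i; exact: piece_le. Qed.

(** All roofs but one use at most half of [pair_sup x], where the base piece has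
    three quarters of it, so the summand [s ^+ 2 / 8 * M x] is a margin that the
    rotund parts, being of size [s ^+ 2 / 32], do not exhaust. *)
Lemma piece_gap x : exists n0, forall n, n != n0 ->
  piece n.+1 x ^+ 2 <= piece 0 x ^+ 2 - s ^+ 2 / 16 * M x ^+ 2.
Proof.
have [n0 Hn0] := pair_sup_half x; exists n0 => n /Hn0 hn.
rewrite !l2sum_sqr; have := weighted_rotund_le n.+1 x.
have := sqr_ge0 (weight * rotund 0 x).
have A0M : M x <= shape 0 x by rewrite /= le_max lexx.
have S0 : 0 <= shape n.+1 x by exact/seminorm_ge0/seminorm_shape.
have Mx := M0 x; have q0 := pair_sup_ge0 x.
have AA : shape n.+1 x <= shape 0 x - s ^+ 2 / 8 * M x.
  rewrite lerBrDr /= le_max; apply/orP; right; rewrite lerD2r.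
  rewrite ler_wpM2l ?c8// lerD2l.
  have : s * `|h n x| <= s * (3 / 4 * pair_sup x).
    by rewrite ler_wpM2l ?(ltW s0)//; lra.
  lra.
have : shape n.+1 x ^+ 2 <= (shape 0 x - s ^+ 2 / 8 * M x) ^+ 2.
  by rewrite ler_pXn2r ?nnegrE//; exact: le_trans AA.
have : s ^+ 2 * M x * M x <= s ^+ 2 * M x * shape 0 x.
  by rewrite ler_wpM2l// mulr_ge0// ltW.
have : s ^+ 2 * (s ^+ 2 * M x ^+ 2) <= 1 * (s ^+ 2 * M x ^+ 2).
  have E1 : s ^+ 2 <= 1 by have := s2; have := s64; lra.
  have Em : 0 <= s ^+ 2 * M x ^+ 2 by apply: mulr_ge0; exact: sqr_ge0.
  exact: ler_wpM2r Em _ _ E1.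
have : 0 <= s ^+ 2 * M x ^+ 2 by rewrite mulr_ge0 ?sqr_ge0.
move: (shape 0 x) (shape n.+1 x) (M x) (s ^+ 2) => A B m E.
move: (weight * _) (weight * _) => C D.
by rewrite !expr2; lra.
Qed.

Lemma defect_piece i x y :
  weight ^+ 2 * defect (rotund i) x y <= defect (piece i) x y.
Proof.
rewrite defect_l2sum (defect_scale (rotund i)) lerDr.
exact/defect_ge0/seminorm_shape.
Qed.

Lemma defect_collapse n x y :
  defect (fun z => V (collapse n z)) x y = defect V (collapse n x) (collapse n y).
Proof.
rewrite /defect; congr (_ - V _ ^+ 2).
have := collapse_linear n 2^-1 (x + y) 0.
have := collapse_linear n 1 x y; rewrite !scale1r => ->.
have -> : collapse n 0 = 0 by rewrite collapse_fixed// functional0.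
by rewrite !addr0.
Qed.

Lemma defect_rotundS n x y : defect (rotund n.+1) x y =
  defect V (collapse n x) (collapse n y) +
    (defect (l2iter weighted n.+1) x y + rate n ^+ 2 * defect V x y).
Proof. by rewrite rotundS 2!defect_l2sum defect_collapse defect_scale. Qed.

(** A midpoint almost on the unit sphere is so for one of the pieces, and the
    defect of that piece is then small. *)
Lemma new_norm_witness x y (t : R) : 0 < t -> t <= 4^-1 ->
  new_norm x <= 1 -> new_norm y <= 1 -> 1 - t <= new_norm (2^-1 *: (x + y)) ->
  exists i, 1 - 4 * t <= piece i x /\ defect (piece i) x y <= 4 * t.
Proof.
move=> t0 t4 Nx Ny Nm.
have [i Hi] := fsup_adherent 0%N piece_le (2^-1 *: (x + y)) t0; exists i.
have sp := seminorm_piece i.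
have px : piece i x <= 1 by exact: le_trans (piece_new_norm _ _) Nx.
have py : piece i y <= 1 by exact: le_trans (piece_new_norm _ _) Ny.
have pm := seminorm_mid x y sp.
move: Hi; rewrite -/new_norm => Hi.
split; first lra.
have : (1 - 2 * t) ^+ 2 <= piece i (2^-1 *: (x + y)) ^+ 2.
  by rewrite ler_pXn2r ?nnegrE ?(seminorm_ge0 _ sp)//; lra.
have : piece i x ^+ 2 <= 1 by rewrite expr_le1// seminorm_ge0.
have : piece i y ^+ 2 <= 1 by rewrite expr_le1// seminorm_ge0.
have := sqr_ge0 t.
by rewrite /defect !expr2; lra.
Qed.

(** * Rotundity of the new norm *)

Lemma new_norm_is_norm : is_norm new_norm.
Proof.
have [ND NZ] := seminorm_new_norm; split=> // x Nx0.
apply: (is_norm_eq0 eM.1); apply/eqP; rewrite eq_le M0 andbT -Nx0.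
exact: new_norm_ge.
Qed.

Lemma new_norm_equivalent : equivalent_norm new_norm.
Proof.
split; first exact: new_norm_is_norm.
have [_ [c [C [c0 C0 ME]]]] := eM; exists c, (2 * C); split => //.
  by rewrite mulr_gt0.
move=> x; have [Mx1 Mx2] := ME x; split.
  exact: le_trans (new_norm_ge x).
apply: (le_trans (new_norm_le x)).
have : s * M x <= 64^-1 * M x by rewrite ler_wpM2r.
have := M0 x; lra.
Qed.

(** Any single roof controls the defect of [V], with a constant that degrades
    with its index. *)
Lemma defect_new_norm_rate x y n (r : R) : 0 <= r ->
  defect (piece n.+1) x y <= weight ^+ 2 * (rate n ^+ 2 * r) ->
  defect V x y <= r.
Proof.
move=> r0 dp; have := le_trans (defect_piece n.+1 x y) dp.
have w20 : 0 < weight ^+ 2 by rewrite exprn_gt0// weight_gt0.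
rewrite ler_pM2l// defect_rotundS => dr.
have r20 : 0 < rate n ^+ 2 by rewrite exprn_gt0// rate_gt0.
rewrite -(ler_pM2l r20); apply: le_trans dr.
rewrite addrA lerDr addr_ge0// defect_ge0//.
exact: seminorm_l2iter seminorm_weighted.
Qed.

Lemma rate_le j n : (n <= j)%N -> rate j <= rate n.
Proof. by move=> nj; rewrite lef_pV2 ?posrE// ler_nat. Qed.

(** The direction [v] is either detected by some [h j], which belongs to all
    roofs of index at least [j], or fixed by all the projections [collapse n]. *)
Lemma new_norm_URED : defect_URED V -> URED new_norm.
Proof.
move=> uV; apply: URED_of_modulus; first exact: new_norm_is_norm.
move=> v v0 a a0.
have w20 : 0 < weight ^+ 2 by rewrite exprn_gt0// weight_gt0.
have [_ [c [C [c0 C0 ME]]]] := eM.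
pose r := 7 / c; have r0 : 0 < r by rewrite divr_gt0.
have xr x : M x <= 7 -> `|x| <= r.
  by move=> x7; rewrite ler_pdivlMr// mulrC; apply: le_trans x7; exact: (ME x).1.
have [t t0 Ht] := uV v v0 r a r0 a0.
have Mx1 x : new_norm x <= 1 -> M x <= 1.
  by move=> Nx; apply: le_trans Nx; exact: new_norm_ge.
(* Finitely many roofs are handled by their multiple of [V]. *)
have small x (l : R) n k (d : R) : (k <= n)%N ->
    new_norm x <= 1 -> new_norm (x + l *: v) <= 1 ->
    d <= weight ^+ 2 * (rate n ^+ 2 * t) ->
    defect (piece k.+1) x (x + l *: v) <= d -> `|l| <= a.
  move=> kn Nx Ny dn dp.
  apply: (Ht x); try by apply: xr; apply: le_trans (Mx1 _ _) _ => //; lra.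
  apply: (@defect_new_norm_rate _ _ k); first exact: ltW.
  apply: (le_trans dp); apply: (le_trans dn); rewrite ler_pM2l// ler_pM2r//.
  by rewrite ler_pXn2r ?nnegrE ?(ltW (rate_gt0 _))// rate_le.
have small0 x (l : R) (d : R) : new_norm x <= 1 -> new_norm (x + l *: v) <= 1 ->
    d <= weight ^+ 2 * t ->
    defect (piece 0) x (x + l *: v) <= d -> `|l| <= a.
  move=> Nx Ny dn dp.
  apply: (Ht x); try by apply: xr; apply: le_trans (Mx1 _ _) _ => //; lra.
  rewrite -(ler_pM2l w20); apply: (le_trans (defect_piece 0 _ _)).
  exact: le_trans dn.
have [[j hj]|hv] := pselect (exists j, h j v != 0).
- pose b := weight ^+ 2 * (2^-1 ^+ j * (a * h j v / 2)) ^+ 2.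
  have b0 : 0 < b.
    rewrite mulr_gt0// exprn_even_gt0//= mulf_neq0// ?expf_neq0//.
    by rewrite !mulf_neq0// gt_eqF.
  pose rj := weight ^+ 2 * (rate j ^+ 2 * t).
  have rj0 : 0 < rj.
    by apply: mulr_gt0 => //; apply: mulr_gt0 => //; rewrite exprn_gt0// rate_gt0.
  pose q := Num.min (b / 8) (Num.min (rj / 4) 4^-1).
  have q0 : 0 < q by rewrite !lt_min !divr_gt0//=.
  have q1 : q <= b / 8 by rewrite ge_min lexx.
  have q2 : q <= rj / 4 by rewrite !ge_min lexx orbT.
  have q3 : q <= 4^-1 by rewrite !ge_min lexx !orbT.
  have rj1 : rj <= weight ^+ 2 * t.
    rewrite ler_pM2l// ler_piMl ?(ltW t0)// expr_le1// ?rate_le1//.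
    exact: ltW (rate_gt0 j).
  exists q => // x l Nx Ny Nm.
  have [i [_ di]] := new_norm_witness q0 q3 Nx Ny Nm.
  case: i di => [|n] di; first by apply: small0 di => //; lra.
  have [nj|jn] := leqP n j; first by apply: (small _ _ j) di => //; rewrite -/rj; lra.
  rewrite leNgt; apply/negP => al.
  have := le_trans (defect_piece n.+1 _ _) di; rewrite defect_rotundS.
  have := @defect_l2iter _ _ weighted n.+1 j x (x + l *: v) seminorm_weighted.
  rewrite ltnS => /(_ (ltnW jn)).
  rewrite defect_scale defect_functional; last exact: frame_h fr j.
  rewrite addrAC subrr add0r (functionalZ _ _ (frame_h fr j)) => d1 d2.
  have : b <= 4 * q.
    apply: le_trans d2; rewrite ler_pM2l//.
    have dV0 z z' : 0 <= defect V z z' by exact: defect_ge0.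
    have r20 : 0 <= rate n ^+ 2 * defect V x (x + l *: v).
      by rewrite mulr_ge0 ?sqr_ge0.
    have := dV0 (collapse n x) (collapse n (x + l *: v)).
    move=> dc0.
    apply: (@le_trans _ _ (defect (l2iter weighted n.+1) x (x + l *: v))); last lra.
    apply: le_trans d1; rewrite exprMn ler_wpM2l ?sqr_ge0//.
    rewrite !exprMn ler_wpM2r ?sqr_ge0// ler_wpM2r ?sqr_ge0//.
    by rewrite -[l ^+ 2]real_normK ?num_real// ler_pXn2r ?nnegrE ?(ltW a0)// ltW.
  lra.
- have hv0 j : h j v = 0.
    by apply/eqP; apply: contra_notT hv => hj; exists j.
  pose q := Num.min (weight ^+ 2 * t / 4) 4^-1.
  have wt0 : 0 < weight ^+ 2 * t by rewrite mulr_gt0.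
  have q0 : 0 < q by rewrite !lt_min !divr_gt0//=.
  have q1 : q <= weight ^+ 2 * t / 4 by rewrite ge_min lexx.
  have q3 : q <= 4^-1 by rewrite !ge_min lexx !orbT.
  exists q => // x l Nx Ny Nm.
  have [i [_ di]] := new_norm_witness q0 q3 Nx Ny Nm.
  case: i di => [|n] di; first by apply: small0 di => //; lra.
  have Tl : collapse n (x + l *: v) = collapse n x + l *: v.
    have := collapse_linear n l v x; rewrite addrC => ->.
    by rewrite collapse_fixed// addrC.
  apply: (Ht (collapse n x)).
  + by apply: xr; apply: (le_trans (collapse_le _ _)); have := Mx1 _ Nx; lra.
  + rewrite -Tl; apply: xr; apply: (le_trans (collapse_le _ _)).
    by have := Mx1 _ Ny; lra.
  + have := le_trans (defect_piece n.+1 _ _) di; rewrite defect_rotundS Tl.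
    have d0 : 0 <= defect (l2iter weighted n.+1) x (x + l *: v).
      exact: defect_ge0 (@seminorm_l2iter _ _ weighted n.+1 seminorm_weighted).
    have r20 : 0 <= rate n ^+ 2 * defect V x (x + l *: v).
      by rewrite mulr_ge0 ?sqr_ge0// defect_ge0.
    move=> dd; rewrite -(ler_pM2l w20).
    apply: (@le_trans _ _ (4 * q)); last lra.
    by apply: le_trans dd; rewrite ler_pM2l//; lra.
Qed.

(** By the gap, only the base piece and one roof can be almost maximal at [x];
    both contain a fixed positive multiple of [V]. *)
Lemma new_norm_LUR : defect_LUR V -> LUR new_norm.
Proof.
move=> lV; apply: LUR_of_modulus; first exact: new_norm_is_norm.
move=> x Nx a a0.
have w20 : 0 < weight ^+ 2 by rewrite exprn_gt0// weight_gt0.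
have x0 : x != 0.
  apply/eqP => x0; move: Nx; rewrite x0 (seminorm0 seminorm_new_norm) => /eqP.
  by rewrite eq_sym oner_eq0.
have Mx0 := equivalent_norm_gt0 eM x0.
have [_ [c [C [c0 C0 NE]]]] := new_norm_equivalent.
have aC0 : 0 < a / C by rewrite divr_gt0.
have [t t0 Ht] := lV x x0 _ aC0.
have [n0 gap] := piece_gap x.
pose d := s ^+ 2 / 16 * M x ^+ 2.
have d0 : 0 < d by rewrite mulr_gt0 ?divr_gt0 ?exprn_gt0.
pose rj := weight ^+ 2 * (rate n0 ^+ 2 * t).
have rj0 : 0 < rj.
    by apply: mulr_gt0 => //; apply: mulr_gt0 => //; rewrite exprn_gt0// rate_gt0.
have rj1 : rj <= weight ^+ 2 * t.
  rewrite ler_pM2l// ler_piMl ?(ltW t0)// expr_le1// ?rate_le1//.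
  exact: ltW (rate_gt0 n0).
pose q := Num.min (d / 16) (Num.min (rj / 4) 4^-1).
have q0 : 0 < q by rewrite !lt_min !divr_gt0//=.
have q1 : q <= d / 16 by rewrite ge_min lexx.
have q2 : q <= rj / 4 by rewrite !ge_min lexx orbT.
have q3 : q <= 4^-1 by rewrite !ge_min lexx !orbT.
exists q => // y Ny Nm.
have Nx1 : new_norm x <= 1 by rewrite Nx.
have [i [xi di]] := new_norm_witness q0 q3 Nx1 Ny Nm.
suff dV : defect V x y <= t.
  apply: (le_trans (NE _).2); have := Ht y dV.
  by rewrite ler_pdivlMr// mulrC.
case: i xi di => [|n] xi di.
  rewrite -(ler_pM2l w20); apply: (le_trans (defect_piece 0 _ _)).
  by apply: (le_trans di); lra.
have [nn0|/gap gp] := eqVneq n n0.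
  apply: (@defect_new_norm_rate _ _ n); first exact: ltW.
  by apply: (le_trans di); rewrite nn0 -/rj; lra.
have : piece 0 x ^+ 2 <= 1.
  rewrite expr_le1// ?(seminorm_ge0 _ (seminorm_piece _))//.
  exact: le_trans (piece_new_norm _ _) Nx1.
have : (1 - 4 * q) ^+ 2 <= piece n.+1 x ^+ 2.
  by rewrite ler_pXn2r ?nnegrE ?(seminorm_ge0 _ (seminorm_piece _))//; lra.
have := sqr_ge0 q.
by move: gp; rewrite -/d !expr2; lra.
Qed.

(** * The new norm is not weakly uniformly rotund *)

(** For [`|r| <= s / 4], a segment along which the roof of index [n] is constant
    and dominates all other pieces. *)
Definition flat_pt n (r : R) : X := u + (4 * s) *: w n + r *: flat_dir n.

Definition flat_shape : R := (1 + 8 * s) * (1 + 4 * s ^+ 2).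

Definition flat_rotund n : R :=
  V (collapse n (flat_pt n 0)) ^+ 2 + l2iter weighted n.+1 (flat_pt n 0) ^+ 2.

(** An upper bound of the new norm on the segment; the summand [rate n] absorbs
    the only part of the roof that varies. *)
Definition flat_level n : R :=
  Num.sqrt (flat_shape ^+ 2 + weight ^+ 2 * flat_rotund n + rate n).

Lemma flat_ptE n r : flat_pt n r = flat_pt n 0 + r *: flat_dir n.
Proof. by rewrite /flat_pt scale0r addr0. Qed.

Lemma flat_pt_le n r : `|r| <= s / 4 -> M (flat_pt n r) <= 1 + 5 * s.
Proof.
move=> rs; apply: (le_trans (sM.1 _ _)).
have := sM.1 u ((4 * s) *: w n); rewrite !sM.2 (frame_Nu fr) (frame_Nw fr).
have := ler_pM (normr_ge0 r) (M0 _) rs (flat_dir_le n).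
by rewrite (ger0_norm (x := 4 * s)) ?mulr_ge0 ?(ltW s0)//; have := s0; lra.
Qed.

Lemma g_flat_pt n r : g (flat_pt n r) = 1.
Proof.
have gl := frame_g fr.
rewrite !(functionalD _ _ gl) !(functionalZ _ _ gl) (functionalD _ _ gl).
by rewrite (frame_gu fr) (frame_ge fr) !(frame_gw fr); ring.
Qed.

Lemma h_flat_pt k n r : h k (flat_pt n r) = 4 * s * h k (w n) + r * h k (w n.+1).
Proof.
rewrite !(functionalD _ _ (hl k)) !(functionalZ _ _ (hl k)) h_flat_dir.
by rewrite (frame_hu fr) add0r.
Qed.

Lemma h_flat_pt_diag n r : h n (flat_pt n r) = 4 * s.
Proof.
by rewrite h_flat_pt (frame_hw_diag fr) (frame_hw_lt fr)// mulr0 addr0 mulr1.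
Qed.

Lemma h_flat_pt_neq k n r : `|r| <= s / 4 -> k != n ->
  `|h k (flat_pt n r)| <= 3 / 4 * s.
Proof.
move=> rs kn; rewrite h_flat_pt; apply: (le_trans (ler_normD _ _)).
rewrite !normrM (ger0_norm (x := 4)) // (gtr0_norm s0).
have := ler_pM (normr_ge0 r) (normr_ge0 _) rs (h_w_le1 k n.+1).
have : s * `|h k (w n)| <= s * 8^-1 by rewrite ler_pM2l// h_w_neq.
by lra.
Qed.

Lemma pair_sup_flat_pt n r : `|r| <= s / 4 ->
  pair_sup (flat_pt n r) <= 19 / 4 * s.
Proof.
move=> rs; apply: (fsup_le (0, 0)%N) => -[i j] /=.
have s0' := s0; have hn := h_flat_pt_diag n r; have hk k := @h_flat_pt_neq k n r rs.
have n4s : `|4 * s| = 4 * s by rewrite ger0_norm// mulr_ge0// ltW.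
case: eqVneq => [_|ij]; first lra.
have [iE|ni] := eqVneq i n.
  have jn : j != n by rewrite -iE eq_sym.
  by rewrite iE hn n4s; have := hk _ jn; lra.
have := hk _ ni; have [->|/hk] := eqVneq j n; last lra.
by rewrite hn n4s; lra.
Qed.

(** On the segment [`|h n|] is [4 * s] while the other [`|h k|] are at most
    [3 / 4 * s]; the factor [3 / 4] in the base piece keeps it below the roof,
    by a margin of order [s ^+ 2], as are the other roofs. *)
Lemma flat_shape_other i n r : `|r| <= s / 4 -> i != n.+1 ->
  shape i (flat_pt n r) <= flat_shape - 3 / 16 * s ^+ 2.
Proof.
move=> rs; have Mz := flat_pt_le n rs; have s0' := s0; have s20' := s20.
have ss : s * s ^+ 2 <= 64^-1 * s ^+ 2 by rewrite ler_pM2r.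
have ss0 : 0 <= s * s ^+ 2 by rewrite mulr_ge0// ltW.
case: i => [|m] im /=; rewrite g_flat_pt normr1 /flat_shape.
  rewrite ge_max; apply/andP; split; first lra.
  have q1 : s * pair_sup (flat_pt n r) <= s * (19 / 4 * s).
    by rewrite ler_pM2l// pair_sup_flat_pt.
  have B1 : 1 + 3 / 4 * (s * pair_sup (flat_pt n r)) <= 1 + 57 / 16 * s ^+ 2.
    by rewrite expr2; lra.
  have M2 : s ^+ 2 * M (flat_pt n r) <= s ^+ 2 * 2.
    by rewrite ler_pM2l//; have := s64; lra.
  have := ler_wpM2l c8 B1; lra.
have h1 : s * `|h m (flat_pt n r)| <= s * (3 / 4 * s).
  by rewrite ler_pM2l// h_flat_pt_neq// -eqSS.
have B1 : 1 + s * `|h m (flat_pt n r)| <= 1 + 3 / 4 * s ^+ 2.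
  by rewrite expr2; lra.
by have := ler_wpM2l c8 B1; lra.
Qed.

Lemma flat_shape_ge1 : 1 <= flat_shape.
Proof.
have s0' := s0; have s20' := s20.
have ss0 : 0 <= s * s ^+ 2 by rewrite mulr_ge0// ltW.
by rewrite /flat_shape; lra.
Qed.

Lemma flat_shape_le2 : flat_shape <= 2.
Proof.
have s0' := s0; have s64' := s64; have s2' := s2.
have ss : s * s ^+ 2 <= 64^-1 * s ^+ 2 by rewrite ler_pM2r.
by rewrite /flat_shape; lra.
Qed.

Lemma shape_flat_pt n r : shape n.+1 (flat_pt n r) = flat_shape.
Proof.
rewrite /= g_flat_pt h_flat_pt_diag normr1 gtr0_norm ?mulr_gt0//.
by rewrite /flat_shape expr2; ring.
Qed.

Lemma flat_pt_le2 n r : `|r| <= s / 4 -> M (flat_pt n r) <= 2.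
Proof. by move=> /(flat_pt_le n); have := s64; lra. Qed.

Lemma M_flat_sqr n r : `|r| <= s / 4 -> M (flat_pt n r) ^+ 2 <= 4.
Proof.
move=> rs; have -> : 4 = 2 ^+ 2 :> R by rewrite expr2; ring.
by rewrite ler_pXn2r ?nnegrE ?M0// flat_pt_le2.
Qed.

Lemma flat_piece_other i n r : `|r| <= s / 4 -> i != n.+1 ->
  piece i (flat_pt n r) ^+ 2 <= flat_shape ^+ 2.
Proof.
move=> rs iN; rewrite piece_sqr; have := weighted_rotund_le i (flat_pt n r).
have := flat_shape_other rs iN; have := M_flat_sqr n rs.
have := seminorm_ge0 (flat_pt n r) (seminorm_shape i).
have := flat_shape_ge1; have := flat_shape_le2.
move: (shape _ _) (M _ ^+ 2) (weight * _) => A m C; move: flat_shape => F.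
move=> F2 F1 A0 m4 AF Cm.
have : A ^+ 2 <= (F - 3 / 16 * s ^+ 2) ^+ 2.
  by rewrite ler_pXn2r ?nnegrE//; exact: le_trans AF.
have := s20; have : s ^+ 2 * m <= s ^+ 2 * 4 by rewrite ler_pM2l.
have : s ^+ 2 * 1 <= s ^+ 2 * F by rewrite ler_pM2l.
have : s ^+ 2 * (s ^+ 2) <= s ^+ 2 * 1.
  by rewrite ler_pM2l//; have := s2; have := s64; lra.
by move: Cm; move: (s ^+ 2) => E; rewrite !expr2; lra.
Qed.

Lemma collapse_flat_pt n r : collapse n (flat_pt n r) = collapse n (flat_pt n 0).
Proof.
rewrite flat_ptE addrC collapse_linear collapse_flat_dir scaler0 add0r//.
Qed.

Lemma l2iter_flat_pt n r :
  l2iter weighted n.+1 (flat_pt n r) = l2iter weighted n.+1 (flat_pt n 0).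
Proof.
apply: eq_l2iter => j jn; rewrite /weighted !h_flat_pt.
by rewrite (frame_hw_lt fr (n := n.+1))// !mulr0.
Qed.

Lemma piece_flat_pt n r : piece n.+1 (flat_pt n r) ^+ 2 =
  flat_shape ^+ 2 + weight ^+ 2 * (flat_rotund n + (rate n * V (flat_pt n r)) ^+ 2).
Proof.
rewrite piece_sqr shape_flat_pt (exprMn _ weight) rotund_sqrS.
by rewrite collapse_flat_pt l2iter_flat_pt addrA.
Qed.

Let flat_rotund_ge0 n : 0 <= flat_rotund n.
Proof. by rewrite addr_ge0 ?sqr_ge0. Qed.

Let rotund_part n r : `|r| <= s / 4 ->
  weight ^+ 2 * (flat_rotund n + (rate n * V (flat_pt n r)) ^+ 2) <= 1.
Proof.
move=> rs; have := weighted_rotund_le n.+1 (flat_pt n r).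
rewrite (exprMn _ weight) rotund_sqrS collapse_flat_pt l2iter_flat_pt addrA.
move/le_trans; apply.
have : s ^+ 2 * M (flat_pt n r) ^+ 2 <= s ^+ 2 * 4.
  by rewrite ler_pM2l// M_flat_sqr.
have := s2; have := s64; lra.
Qed.

Lemma flat_level_sqr n : flat_level n ^+ 2 =
  flat_shape ^+ 2 + weight ^+ 2 * flat_rotund n + rate n.
Proof.
by rewrite sqr_sqrtr// addr_ge0 ?(ltW (rate_gt0 n))// addr_ge0 ?sqr_ge0//
  mulr_ge0// sqr_ge0.
Qed.

Lemma flat_level_ge1 n : 1 <= flat_level n.
Proof.
rewrite -(ler_pXn2r (n := 2)) ?nnegrE ?sqrtr_ge0// flat_level_sqr.
have : 1 ^+ 2 <= flat_shape ^+ 2.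
  by rewrite ler_pXn2r ?nnegrE ?flat_shape_ge1// (le_trans _ flat_shape_ge1).
have := rate_gt0 n; have : 0 <= weight ^+ 2 * flat_rotund n.
  by rewrite mulr_ge0// sqr_ge0.
lra.
Qed.

Lemma flat_level_le n : flat_level n <= 4.
Proof.
rewrite -(ler_pXn2r (n := 2)) ?nnegrE ?sqrtr_ge0// flat_level_sqr.
have : flat_shape ^+ 2 <= 2 ^+ 2.
  by rewrite ler_pXn2r ?nnegrE ?flat_shape_le2// (le_trans _ flat_shape_ge1).
have := rate_le1 n; have r0 : `|0 : R| <= s / 4 by rewrite normr0 divr_ge0// ltW.
have := rotund_part n r0; rewrite mulrDr.
have : 0 <= weight ^+ 2 * (rate n * V (flat_pt n 0)) ^+ 2.
  by rewrite mulr_ge0// sqr_ge0.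
by rewrite !expr2; lra.
Qed.

Lemma new_norm_flat_pt n r : `|r| <= s / 4 ->
  new_norm (flat_pt n r) <= flat_level n.
Proof.
move=> rs; apply: (fsup_le 0%N) => i.
rewrite -(ler_pXn2r (n := 2)) ?nnegrE ?sqrtr_ge0 ?l2sum_ge0// flat_level_sqr.
have [->|iN] := eqVneq i n.+1; last first.
  have := flat_piece_other rs iN; have := rate_gt0 n.
  have : 0 <= weight ^+ 2 * flat_rotund n by rewrite mulr_ge0// sqr_ge0.
  lra.
rewrite piece_flat_pt mulrDr addrA lerD2l exprMn mulrCA.
have r1 := rate_le1 n; have r0 := ltW (rate_gt0 n).
have wV : weight ^+ 2 * V (flat_pt n r) ^+ 2 <= 1.
  have := weighted_rotund_le 0 (flat_pt n r); rewrite exprMn => /le_trans; apply.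
  have : s ^+ 2 * M (flat_pt n r) ^+ 2 <= s ^+ 2 * 4.
    by rewrite ler_pM2l// M_flat_sqr.
  have := s2; have := s64; lra.
have : rate n ^+ 2 * (weight ^+ 2 * V (flat_pt n r) ^+ 2) <= rate n ^+ 2 * 1.
  by rewrite ler_wpM2l// sqr_ge0.
have : rate n * rate n <= rate n * 1 by rewrite ler_wpM2l.
by rewrite (expr2 (rate n)); lra.
Qed.

(** A number in [0, 1] is at least its square, and the square is easily
    compared with [flat_level n ^+ 2]. *)
Lemma new_norm_flat_mid n :
  1 - rate n <= new_norm ((flat_level n)^-1 *: flat_pt n 0) <= 1.
Proof.
have r0 : `|0 : R| <= s / 4 by rewrite normr0 divr_ge0// ltW.
have L1 := flat_level_ge1 n; have L0 : 0 < flat_level n by exact: lt_le_trans L1.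
have N1 : new_norm ((flat_level n)^-1 *: flat_pt n 0) <= 1.
  rewrite (seminormZ _ seminorm_new_norm) ?invr_ge0 ?(ltW L0)//.
  by rewrite mulrC ler_pdivrMr// mul1r new_norm_flat_pt.
rewrite N1 andbT.
apply: (@le_trans _ _ (new_norm ((flat_level n)^-1 *: flat_pt n 0) ^+ 2)); last first.
  by rewrite expr2 ler_piMl// (seminorm_ge0 _ seminorm_new_norm).
rewrite (seminormZ _ seminorm_new_norm) ?invr_ge0 ?(ltW L0)//.
rewrite mulrC exprMn exprVn ler_pdivlMr ?exprn_gt0//.
apply: (@le_trans _ _ (piece n.+1 (flat_pt n 0) ^+ 2)); last first.
  rewrite ler_pXn2r ?nnegrE ?l2sum_ge0 ?piece_new_norm//.
  exact/seminorm_ge0/seminorm_new_norm.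
rewrite piece_flat_pt mulrBl mul1r {1}flat_level_sqr.
have : rate n * 1 <= rate n * flat_level n ^+ 2.
  by rewrite ler_wpM2l ?(ltW (rate_gt0 n))// exprn_ege1.
have : 0 <= weight ^+ 2 * (rate n * V (flat_pt n 0)) ^+ 2.
  by rewrite mulr_ge0// sqr_ge0.
lra.
Qed.

(** The end points of the normalised segments differ by
    [s / 2 / flat_level n] times [flat_dir n], on which [f] is 1, whereas
    [flat_level n <= 4]. *)
Lemma new_norm_not_WUR : ~ WUR new_norm.
Proof.
move=> uN.
have sN := seminorm_new_norm.
have L0 n : 0 < flat_level n by exact: lt_le_trans (flat_level_ge1 n).
pose x n := (flat_level n)^-1 *: flat_pt n (- (s / 4)).
pose y n := (flat_level n)^-1 *: flat_pt n (s / 4).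
have s40 : 0 <= s / 4 by rewrite divr_ge0// ltW.
have ball n r : `|r| <= s / 4 -> unit_ball new_norm ((flat_level n)^-1 *: flat_pt n r).
  move=> rs; rewrite /unit_ball/= (seminormZ _ sN) ?invr_ge0 ?(ltW (L0 n))//.
  by rewrite mulrC ler_pdivrMr// mul1r new_norm_flat_pt.
have mid n : 2^-1 *: (x n + y n) = (flat_level n)^-1 *: flat_pt n 0.
  rewrite -scalerDr scalerA mulrC -scalerA; congr (_ *: _).
  rewrite !(flat_ptE _ (_ / _)) (flat_ptE _ (- _)) scaleNr addrACA addNr addr0.
  rewrite scalerDr -scalerDl (_ : 2^-1 + 2^-1 = 1) ?scale1r//; lra.
have diff n : y n - x n = (s / 2 / flat_level n) *: flat_dir n.
  rewrite -scalerBr (flat_ptE _ (s / 4)) (flat_ptE _ (- _)) opprD addrACA subrr.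
  rewrite add0r -scalerBl opprK scalerA; congr (_ *: _).
  by field; rewrite gt_eqF.
have : (y n - x n) @[n --> \oo] --> (0 : weak_topology X).
  apply: (uN x y).
- by move=> n; apply: ball; rewrite normrN ger0_norm.
- by move=> n; apply: ball; rewrite ger0_norm.
- under eq_fun do rewrite mid.
  by apply: cvg_to1 => n; exact: new_norm_flat_mid.
move=> /weak_cvgP; have [F [Fc Ff]] :=
  functional_continuous (frame_f fr) eM (ltr0Sn R 2) (frame_fN fr).
move=> /(_ F Fc); rewrite linear0 => /cvgrPdist_lt/(_ (s / 8)).
rewrite divr_gt0// => /(_ isT)[n _ /(_ n (leqnn n))] /=.
rewrite sub0r normrN diff linearZ/= Ff (functionalD _ _ (frame_f fr)).
rewrite (frame_fe fr) (frame_fw fr) addr0.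
have L4 := flat_level_le n; have Ln := L0 n.
rewrite /GRing.scale/= mulr1 gtr0_norm ?divr_gt0// ltr_pdivrMr// ltNge.
move=> /negP; apply; have : s / 8 * flat_level n <= s / 8 * 4.
  by rewrite ler_pM2l ?divr_gt0.
lra.
Qed.

End Construction.

(** * Density *)

Section Density.
Context (R : realType) (X : normedModType R).
Implicit Types (M N U L V : X -> R).

Lemma equivalent_norm_scale M (a : R) : 0 < a -> equivalent_norm M ->
  equivalent_norm (fun x => a * M x).
Proof.
move=> a0 [nM [c [C [c0 C0 ME]]]]; split.
  have [ND NZ] := seminorm_scale (ltW a0) (is_norm_seminorm nM).
  split=> // x /eqP; rewrite mulf_eq0 gt_eqF//= => /eqP.
  exact: is_norm_eq0 nM x.
exists (a * c), (a * C); split; rewrite ?mulr_gt0// => x.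
by have [Mx1 Mx2] := ME x; rewrite -!mulrA !ler_pM2l.
Qed.

Lemma equivalent_norm_dominates M N : equivalent_norm M -> equivalent_norm N ->
  exists2 K : R, 0 < K & forall x, N x <= K * M x.
Proof.
move=> [_ [c [C [c0 C0 ME]]]] [_ [d [D [d0 D0 NE]]]].
exists (D / c); first by rewrite divr_gt0.
move=> x; apply: (le_trans (NE x).2); rewrite -mulrA ler_pM2l//.
by rewrite ler_pdivlMl//; exact: (ME x).1.
Qed.

(** The construction approximates from above, so it is applied to
    [(1 + eps)^-1 * M]. *)
Lemma URED_not_WUR_approximation M V (K eps : R) :
  infinite_dimensional X -> equivalent_norm M -> seminorm V ->
  0 < K -> (forall x, V x <= K * M x) -> defect_URED V -> 0 < eps ->
  exists N, [/\ equivalent_norm N, URED N, ~ WUR N, defect_LUR V -> LUR N &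
    forall x, N x <= M x /\ M x <= (1 + eps) * N x].
Proof.
move=> infX eM sV K0 VK uV eps0.
have e1 : 0 < 1 + eps by rewrite addr_gt0.
pose M' x := (1 + eps)^-1 * M x.
have eM' : equivalent_norm M' by apply: equivalent_norm_scale; rewrite ?invr_gt0.
have sM' := is_norm_seminorm eM'.1.
have MM' x : M x = (1 + eps) * M' x by rewrite /M' mulVKf// gt_eqF.
have [u [e [g [f [w [h fr]]]]]] := exists_frame infX sM' (is_norm_eq0 eM'.1).
pose s : R := Num.min 64^-1 (eps / 24).
have s0 : 0 < s by rewrite lt_min invr_gt0 ltr0n divr_gt0.
have s64 : s <= 64^-1 by rewrite ge_min lexx.
have s24 : s <= eps / 24 by rewrite ge_min lexx orbT.
have K'0 : 0 < K * (1 + eps) by rewrite mulr_gt0.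
have VK' x : V x <= K * (1 + eps) * M' x by rewrite -mulrA -MM'.
exists (new_norm M' V e g w h (K * (1 + eps)) s); split.
- exact: new_norm_equivalent eM' sV VK' K'0 s0 s64 fr.
- exact: new_norm_URED eM' sV VK' K'0 s0 s64 fr uV.
- exact: new_norm_not_WUR eM' sV VK' K'0 s0 s64 fr.
- exact: new_norm_LUR eM' sV VK' K'0 s0 s64 fr.
- move=> x; rewrite MM'; split.
    apply: (le_trans (new_norm_le eM' sV VK' K'0 s0 s64 fr x)).
    by rewrite ler_wpM2r ?(seminorm_ge0 _ sM')//; lra.
  by rewrite ler_pM2l//; exact: new_norm_ge eM' sV VK' K'0 s0 s64 fr x.
Qed.

Lemma defect_URED_l2sum U L : seminorm U -> seminorm L -> defect_URED U ->
  defect_URED (l2sum U L).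
Proof.
move=> sU sL uU v v0 r a r0 a0; have [t t0 Ht] := uU v v0 r a r0 a0.
exists t => // x l xr yr d; apply: (Ht x) => //; apply: le_trans d.
by rewrite defect_l2sum lerDl defect_ge0.
Qed.

Lemma defect_LUR_l2sum U L : seminorm U -> seminorm L -> defect_LUR L ->
  defect_LUR (l2sum U L).
Proof.
move=> sU sL lL x x0 a a0; have [t t0 Ht] := lL x x0 a a0.
exists t => // y d; apply: (Ht y) => //; apply: le_trans d.
by rewrite defect_l2sum lerDr defect_ge0.
Qed.

End Density.

Theorem theorem2 (R : realType) (X : completeNormedModType R)
    (hdim : infinite_dimensional X)
    (hURED : exists N : X -> R, equivalent_norm N /\ URED N) :
  ((exists N : X -> R, [/\ equivalent_norm N, URED N & ~ WUR N]) /\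
   dense_norms [set N : X -> R | [/\ equivalent_norm N, URED N & ~ WUR N]]) /\
  ((exists N : X -> R, equivalent_norm N /\ LUR N) ->
   (exists N : X -> R, [/\ equivalent_norm N, URED N, LUR N & ~ WUR N]) /\
   dense_norms
     [set N : X -> R | [/\ equivalent_norm N, URED N, LUR N & ~ WUR N]]).
Proof.
have [U [eU uU]] := hURED.
have sU := is_norm_seminorm eU.1.
have uU' := URED_defect eU uU.
have first_part (M : X -> R) (eps : R) : equivalent_norm M -> 0 < eps ->
    exists N : X -> R, [/\ equivalent_norm N, URED N & ~ WUR N] /\
      forall x, N x <= M x /\ M x <= (1 + eps) * N x.
  move=> eM eps0; have [K K0 UK] := equivalent_norm_dominates eM eU.
  have [N [eN uN wN _ NM]] :=
    URED_not_WUR_approximation hdim eM sU K0 UK uU' eps0.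
  by exists N.
split.
  split; last by move=> M eM eps eps0; exact: first_part.
  by have [N [HN _]] := first_part U 1 eU ltr01; exists N.
move=> [L [eL lL]]; have sL := is_norm_seminorm eL.1.
have sV := seminorm_l2sum sU sL.
have uV := defect_URED_l2sum sU sL uU'.
have lV := defect_LUR_l2sum sU sL (LUR_defect eL lL).
have second_part (M : X -> R) (eps : R) : equivalent_norm M -> 0 < eps ->
    exists N : X -> R, [/\ equivalent_norm N, URED N, LUR N & ~ WUR N] /\
      forall x, N x <= M x /\ M x <= (1 + eps) * N x.
  move=> eM eps0; have [K K0 UK] := equivalent_norm_dominates eM eU.
  have [K' K'0 LK] := equivalent_norm_dominates eM eL.
  have VK x : l2sum U L x <= (K + K') * M x.
    by apply: (le_trans (l2sum_le x sU sL)); rewrite mulrDl lerD.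
  have [N [eN uN wN lN NM]] :=
    URED_not_WUR_approximation hdim eM sV (addr_gt0 K0 K'0) VK uV eps0.
  by exists N; split=> //; split=> //; exact: lN.
split; last by move=> M eM eps eps0; exact: second_part.
by have [N [HN _]] := second_part U 1 eU ltr01; exists N.
Qed.
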